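(* There is a fixed constant $\delta\geq 1/100$ and a set-multilinear polynomial $G_{n,n}$ in $\mathsf{VBP}$, in $\Theta(n^2)$ variables and of degree $\Theta(n)$, such that any $\sum\mathsf{smABP}$ computing $G_{n,n}$ requires total-width $\exp(\Omega(n^{\delta}))$.
   Context: A polynomial is set-multilinear with respect to a partition $(X_1,\ldots,X_m)$ of its variables if every monomial contains exactly one variable from each $X_i$. Given such a partition, a set-multilinear algebraic branching program (ABP) of depth $m$ is ordered with respect to a permutation $\sigma\in S_m$ if it is a layered directed acyclic graph with a start node (layer $0$) and an end node (layer $m$), all edges going from layer $\ell-1$ to layer $\ell$, and every edge from layer $\ell-1$ to layer $\ell$ labelled by a linear form in the variables of $X_{\sigma(\ell)}$; it computes the sum over all start-to-end paths of the product of the edge labels. Its width is the maximum number of nodes in a layer. A $\sum\mathsf{smABP}$ computing a polynomial $P$ that is set-multilinear with respect to the partition is an expression $\sum_{i=1}^t A_i=P$ where each $A_i$ is a set-multilinear ABP ordered with respect to some (possibly different) permutation $\sigma_i$; its total-width is the sum of the widths of the $A_i$. $\mathsf{VBP}$ is the class of polynomial families of polynomially bounded degree computable by polynomial-size algebraic branching programs (layered DAGs with edges labelled by linear polynomials, computing the sum over start-to-end paths of products of labels). *)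

(* Defs.v *)
From HB Require Import structures.
From mathcomp Require Import all_boot all_order all_algebra all_fingroup.
From mathcomp Require Import mpoly.
From Stdlib Require Reals.

Import GRing.Theory.
Local Open Scope ring_scope.

(* Layer indices: edges of level l : 'I_m go from layer lo l to layer hi l. *)
Definition lo {m : nat} (l : 'I_m) : 'I_m.+1 := widen_ord (leqnSn m) l.
Definition hi {m : nat} (l : 'I_m) : 'I_m.+1 := lift ord0 l.


(* total degree of a polynomial (0 for the zero polynomial) *)
Definition tdeg {F : fieldType} {N : nat} (p : {mpoly F[N]}) : nat := (msize p).-1.

Definition set_multilinear {F : fieldType} {N m : nat} (part : 'I_N -> 'I_m) (p : {mpoly F[N]}) :=
  forall mon : 'X_{1..N}, mon \in msupp p ->
    forall j : 'I_m, (\sum_(i : 'I_N | part i == j) mon i)%N = 1%N.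

Definition linear_form_in {F : fieldType} {N m : nat} (part : 'I_N -> 'I_m) (j : 'I_m)
    (q : {mpoly F[N]}) :=
  exists c : 'I_N -> F, q = \sum_(i : 'I_N | part i == j) c i *: 'X_i.

Definition affine_linear {F : fieldType} {N : nat} (q : {mpoly F[N]}) := (msize q <= 2)%N.

(* Set-multilinear ABP of depth m ordered w.r.t. sigma : 'S_m.
   Layer l (l = 0..m) has nodes 'I_(lw l); layers 0 and m are the start and
   end node. An edge from layer l to l+1 (l : 'I_m, i.e. the paper's level
   l+1) between nodes u,v carries the label lab l u v (label 0 = no edge),
   a linear form in the variables of X_{sigma l}. *)
Record smABP (F : fieldType) (N m : nat) (part : 'I_N -> 'I_m) := SmABP {
  sm_sigma : 'S_m;
  sm_lw : 'I_m.+1 -> nat;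
  sm_lab : forall l : 'I_m, 'I_(sm_lw (lo l)) -> 'I_(sm_lw (hi l)) -> {mpoly F[N]};
  sm_start : sm_lw ord0 = 1%N;
  sm_end : sm_lw ord_max = 1%N;
  sm_lin : forall l u v, linear_form_in part (sm_sigma l) (sm_lab l u v)
}.
Arguments sm_sigma {F N m part}.
Arguments sm_lw {F N m part}.
Arguments sm_lab {F N m part}.

Definition sm_poly {F : fieldType} {N m : nat} {part : 'I_N -> 'I_m} (A : smABP F N m part) : {mpoly F[N]} :=
  \sum_(p : {dffun forall l : 'I_m.+1, 'I_(sm_lw A l)})
     \prod_(l < m) sm_lab A l (p (lo l)) (p (hi l)).

Definition sm_width {F : fieldType} {N m : nat} {part : 'I_N -> 'I_m} (A : smABP F N m part) : nat :=
  \max_(l < m.+1) sm_lw A l.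

Definition sum_smABP_computes {F : fieldType} {N m : nat} {part : 'I_N -> 'I_m}
    (s : seq (smABP F N m part)) (P : {mpoly F[N]}) :=
  \sum_(A <- s) sm_poly A = P.

Definition total_width {F : fieldType} {N m : nat} {part : 'I_N -> 'I_m} (s : seq (smABP F N m part)) : nat :=
  (\sum_(A <- s) sm_width A)%N.

Record ABP (F : fieldType) (N : nat) := MkABP {
  abp_depth : nat;
  abp_lw : 'I_abp_depth.+1 -> nat;
  abp_lab : forall l : 'I_abp_depth,
      'I_(abp_lw (lo l)) -> 'I_(abp_lw (hi l)) -> {mpoly F[N]};
  abp_start : abp_lw ord0 = 1%N;
  abp_end : abp_lw ord_max = 1%N;
  abp_aff : forall l u v, affine_linear (abp_lab l u v)
}.
Arguments abp_depth {F N}.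
Arguments abp_lw {F N}.
Arguments abp_lab {F N}.

Definition abp_poly {F : fieldType} {N : nat} (A : ABP F N) : {mpoly F[N]} :=
  \sum_(p : {dffun forall l : 'I_(abp_depth A).+1, 'I_(abp_lw A l)})
     \prod_(l < abp_depth A) abp_lab A l (p (lo l)) (p (hi l)).

Definition abp_size {F : fieldType} {N : nat} (A : ABP F N) : nat := (\sum_(l < (abp_depth A).+1) abp_lw A l)%N.

Definition inVBP {F : fieldType} {Nv : nat -> nat} (G : forall n, {mpoly F[Nv n]}) :=
  exists k : nat, forall n : nat,
    (tdeg (G n) <= n ^ k + k)%N /\
    exists A : ABP F (Nv n), abp_poly A = G n /\ (abp_size A <= n ^ k + k)%N.

Definition bigTheta (f g : nat -> nat) :=
  exists c1 c2 : Rdefinitions.R, Rdefinitions.Rlt Rdefinitions.R0 c1 /\ Rdefinitions.Rlt Rdefinitions.R0 c2 /\ exists n0 : nat, forall n : nat,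
    (n0 <= n)%N -> Rdefinitions.Rle (Rdefinitions.Rmult c1 (Raxioms.INR (g n))) (Raxioms.INR (f n)) /\
                   Rdefinitions.Rle (Raxioms.INR (f n)) (Rdefinitions.Rmult c2 (Raxioms.INR (g n))).

(* Main.v *)
Require Import Defs.
From mathcomp Require Import all_boot all_order all_algebra all_fingroup.
From mathcomp Require Import mpoly.
From Stdlib Require Reals.
From Stdlib Require Lra.
From mathcomp Require Import zify ring.

Set Implicit Arguments.
Unset Strict Implicit.
Unset Printing Implicit Defensive.

Import Order.TTheory GRing.Theory Num.Theory.

(** The hard polynomial is a product over [r] groups of [2 b] parts [u_i], [v_i].
    In each group a selector variable [s_k] chooses a shift [k], and the group
    contributes [\sum_k s_k \prod_i (u_i0 v_(i+k)0 + u_i1 v_(i+k)1)], so that the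
    parts are matched along [i -> i + k].  This is a sum of products, hence easy
    for ABPs.

    For the lower bound, fix the shifts and give one end of each of the [r b]
    matched pairs to a row player and the other end to a column player.  The
    evaluations of the polynomial at 0/1 points then form an identity matrix of
    size [2 ^ (r b)].  Cutting an ordered ABP of width [w] at a layer writes its
    matrix as a sum of [w 2 ^ (r b - D)] rank-one matrices, if the parts read before
    the cut are split between the two players with imbalance [D].

    Given fewer than [2 ^ r] orders, cut each of them into chunks of [C] parts,
    where [r << C << b].  A random shift makes most pairs of a given group cross
    between chunks, and all groups fail to do so with probability at most
    [(2 C / b) ^ r]; so some choice of shifts has a good group for every order.
    A random distribution of the ends then keeps every prefix of a given order
    balanced up to [D = r] only if each of at least [r] chunks has its imbalance
    in a window that is short compared to the square root of the number of its
    pairs, which has probability at most [2 ^ (- r)].  So some distribution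
    unbalances all the orders simultaneously, and the total width is at least
    [2 ^ r]. *)

(** * Counting balanced sign patterns *)

Lemma leq_bin_succ n m : m.*2 < n -> 'C(n, m) <= 'C(n, m.+1).
Proof.
move=> lt_mn; rewrite -(@leq_pmul2l m.+1) // mul_bin_left leq_mul2r.
by apply/orP; right; lia.
Qed.

Lemma leq_bin_central h j : 'C(h.*2, j) <= 'C(h.*2, h).
Proof.
have below i : i <= h -> 'C(h.*2, i) <= 'C(h.*2, h).
  move=> le_ih; rewrite -(subKn le_ih); move: (h - i) (leq_subr i h) => d.
  elim: d => [|d IHd] le_dh; first by rewrite subn0.
  apply: leq_trans (IHd (ltnW le_dh)).
  by rewrite -(subnSK le_dh); apply: leq_bin_succ; lia.
have [/below//|lt_hj] := leqP j h.
have [le_j|lt_j] := leqP j h.*2; last by rewrite bin_small.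
by rewrite -bin_sub // below //; lia.
Qed.

(** The bound [4 ^ h / sqrt (2 h + 1)] on the central coefficient, squared to stay in [nat].
    Consecutive coefficients have ratio [2 (2 h + 1) / (h + 1)], and
    [(2 h + 1) (2 h + 3) <= 4 (h + 1) ^ 2]. *)
Lemma bin_central_sqr h : 'C(h.*2, h) ^ 2 * h.*2.+1 <= 16 ^ h.
Proof.
elim: h => [|h IHh] //.
have step : h.+1 * 'C(h.+1.*2, h.+1) = 2 * h.*2.+1 * 'C(h.*2, h).
  have E1 : h.+1 * 'C(h.*2.+2, h.+1) = h.*2.+2 * 'C(h.*2.+1, h).
    by rewrite mul_bin_diag.
  have E2 : h.+1 * 'C(h.*2.+1, h) = h.*2.+1 * 'C(h.*2, h).
    rewrite -(@bin_sub h.*2.+1 h); last by lia.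
    rewrite (_ : h.*2.+1 - h = h.+1); last by lia.
    by rewrite mul_bin_diag.
  have E3 : h.*2.+2 * 'C(h.*2.+1, h) = 2 * (h.+1 * 'C(h.*2.+1, h)).
    by rewrite mulnA -doubleS -mul2n.
  by rewrite doubleS E1 E3 E2 mulnA.
rewrite -(@leq_pmul2l (h.+1 ^ 2)) ?expn_gt0 //.
rewrite mulnA -expnMn step [16 ^ h.+1]expnS.
move: ('C(h.*2, h)) (16 ^ h) IHh => c x IHh.
apply: (@leq_trans (4 * h.*2.+1 * h.*2.+3 * (c ^ 2 * h.*2.+1))).
  by rewrite doubleS !expnS !expn0; lia.
apply: leq_trans (leq_mul (leqnn _) IHh) _.
by rewrite [leqRHS]mulnA leq_mul2r; apply/orP; right; rewrite !expnS !expn0; nia.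
Qed.

(** The hypothesis bounds the spread of [P] without naming an interval; the least member of [P]
    serves as its left end. *)
Lemma card_window n w (P : pred nat) :
    (forall i j, P i -> P j -> j < i + w) -> #|[pred j : 'I_n | P j]| <= w.
Proof.
move=> closeP; case: (pickP [pred j : 'I_n | P j]) => [j0 Pj0|P0]; last first.
  by rewrite (eq_card0 P0).
pose i0 := [arg min_(i < j0 | P i) (i : nat)].
have [Pi0 min0] : P i0 /\ forall j : 'I_n, P j -> i0 <= j.
  by rewrite /i0; case: arg_minnP.
rewrite cardE -(size_map val) -[leqRHS](size_iota i0 w).
apply: uniq_leq_size; first by rewrite map_inj_uniq ?enum_uniq //; apply: val_inj.
move=> x /mapP[j]; rewrite mem_enum inE => Pj ->.
by rewrite mem_iota min0 //= closeP.
Qed.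

(** * Random sign patterns and resampling of blocks *)

Section Flips.

Variable E : finType.
Implicit Types (e : E) (x y K : {set E}).

(** A subset encodes a sign pattern, its members having sign -1; [symdiff x y] flips the signs on
    [y]. *)
Definition symdiff x y := [set e | (e \in x) (+) (e \in y)].

Lemma symdiffK y : involutive (symdiff^~ y).
Proof. by move=> x; apply/setP=> e; rewrite !inE addbK. Qed.

Lemma subset_symdiff K x y : y \subset K -> (symdiff x y \subset K) = (x \subset K).
Proof.
move=> yK; apply/subsetP/subsetP => sub e.
  move=> ex; case ey: (e \in y); first exact: (subsetP yK).
  by apply: sub; rewrite inE ex ey.
by rewrite inE; case ey: (e \in y); [rewrite (subsetP yK)| rewrite addbF => /sub].
Qed.

(** Only [w] cardinalities occur, and each is shared by at most a central binomial number of
    subsets. *)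
Lemma card_pow_window K (h w : nat) (P : pred nat) :
    #|K| = h.*2 -> (forall i j, P i -> P j -> j < i + w) ->
  #|[set x in powerset K | P #|x|]| <= w * 'C(h.*2, h).
Proof.
move=> cardK closeP.
rewrite -sum1_card (partition_big (fun x => inord #|x| : 'I_h.*2.+1) (fun j => P j)) /=.
  apply: (@leq_trans (\sum_(j < h.*2.+1 | P j) 'C(h.*2, h))); last first.
    by rewrite sum_nat_const leq_mul2r card_window ?orbT.
  apply: leq_sum => j Pj.
  apply: leq_trans (leq_bin_central h j); 
  have -> : 'C(h.*2, j) = 'C(#|K|, j) by rewrite cardK.
  rewrite -cards_draws sum1_card.
  apply/subset_leq_card/subsetP => x; rewrite unfold_in !inE => /andP[/andP[xK Px] /eqP <-].
  by rewrite xK inordK ?eqxx // ltnS -cardK subset_leq_card.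
move=> x; rewrite !inE => /andP[xK Px].
by rewrite inordK // ltnS -cardK subset_leq_card.
Qed.

(** Conditioning without conditional probabilities: flipping a uniform [y] inside [K] preserves the
    counting measure and the event [f], while for each fixed [x] at most [B] choices of [y] give
    [g]. The proof counts pairs [(x, y)] in both orders. *)
Lemma card_resample K (f g : pred {set E}) (B : nat) :
    (forall x y, y \subset K -> f (symdiff x y) = f x) ->
    (forall x, #|[set y in powerset K | g (symdiff x y)]| <= B) ->
  #|[pred x | f x && g x]| * 2 ^ #|K| <= #|[pred x | f x]| * B.
Proof.
move=> fK gB; rewrite mulnC -card_powerset -sum_nat_const.
have -> : \sum_(y in powerset K) #|[pred x | f x && g x]|
   = \sum_(x : {set E}) f x * #|[set y in powerset K | g (symdiff x y)]|.
  transitivity (\sum_(y in powerset K) \sum_(x : {set E}) (f x && g (symdiff x y) : nat)).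
    apply: eq_bigr => y; rewrite inE => yK.
    rewrite -sum1_card big_mkcond (reindex_inj (inv_inj (symdiffK y))) /=.
    by apply: eq_bigr => x _; rewrite inE fK //; case: (_ && _).
  rewrite exchange_big /=; apply: eq_bigr => x _.
  rewrite -sum1_card big_distrr /= [LHS]big_mkcond [RHS]big_mkcond /=.
  apply: eq_bigr => y _; rewrite !inE; case: (y \subset K) => //=.
  by case: (f x); case: (g _).
rewrite -sum1_card big_distrl /= [X in _ <= X]big_mkcond /=.
by apply: leq_sum => x _; rewrite inE; case: (f x) => //; rewrite !mul1n gB.
Qed.

(* The events [g t] for [t] in [ts] are triangular with respect to the blocks
   [K t], so conditioning on the earlier blocks halves the count at each [t]. *)
Lemma card_triangular (K : nat -> {set E}) (g : nat -> pred {set E}) (ts : seq nat) :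
    sorted ltn ts ->
    (forall t t' x y, t' < t -> y \subset K t -> g t' (symdiff x y) = g t' x) ->
    (forall t x, t \in ts ->
       2 * #|[set y in powerset (K t) | g t (symdiff x y)]| <= 2 ^ #|K t|) ->
  #|[pred x | all (g^~ x) ts]| * 2 ^ size ts <= 2 ^ #|E|.
Proof.
(* The largest index is removed first: resampling its block leaves all the earlier events
   unchanged. *)
elim/last_ind: ts => [|ts t IHts] sorted_ts triang half.
  by rewrite muln1 -cardsT -card_powerset; apply/subset_leq_card/subsetP => x _; rewrite powersetE subsetT.
have [sorted' lt_ts] : sorted ltn ts /\ all (ltn^~ t) ts.
  move: sorted_ts; rewrite -cats1 sorted_pairwise; last exact: ltn_trans.
  rewrite pairwise_cat => /and3P[]; rewrite allrel1r => -> + _.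
  by rewrite -sorted_pairwise //; apply: ltn_trans.
have {}IHts := IHts sorted' triang.
have half' t' x : t' \in ts ->
    2 * #|[set y in powerset (K t') | g t' (symdiff x y)]| <= 2 ^ #|K t'|.
  by move=> t'ts; apply: half; rewrite mem_rcons inE t'ts orbT.
apply: leq_trans (IHts half').
rewrite size_rcons expnSr [2 ^ size ts * 2]mulnC mulnA leq_mul2r; apply/orP; right.
rewrite -(@leq_pmul2r (2 ^ #|K t|)) ?expn_gt0 //.
pose B := \max_x #|[set y in powerset (K t) | g t (symdiff x y)]|.
have BK : B * 2 <= 2 ^ #|K t|.
  rewrite mulnC /B; elim/big_ind: _ => [|a b Ha Hb|x _]; first by rewrite muln0.
    by rewrite maxnMr geq_max Ha.
  by apply: half; rewrite mem_rcons inE eqxx.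
apply: (@leq_trans (#|[pred x | all (g^~ x) ts]| * B * 2)); last by rewrite -mulnA leq_mul2l BK orbT.
rewrite -mulnA [2 * _]mulnC mulnA leq_mul2r /=.
apply: leq_trans (@card_resample (K t) (fun x => all (g^~ x) ts) (g t) B _ _).
- by rewrite leq_mul2r; apply/orP; right; apply/subset_leq_card/subsetP => x; rewrite !inE all_rcons andbC.
- move=> x y yK; apply: eq_in_all => t' t'ts; apply: triang yK.
  exact: (allP lt_ts).
- by move=> x; apply: (leq_bigmax x).
Qed.

End Flips.

(** * Imbalance of chunks under random signs *)

Section Chunks.

Variables (E : finType) (cu cv : E -> nat).
Implicit Types (e : E) (x y : {set E}) (t : nat).

(** A pair whose ends lie in different chunks is attributed to the earlier of the two. Its sign then
    cannot affect chunks before [t], which is the triangularity needed for conditioning. *)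
Definition forward t := [set e | (cu e != cv e) && (minn (cu e) (cv e) == t)].

Definition chunk_imbalance t x : int :=
  (\sum_e (-1) ^+ (e \in x) * ((cu e == t)%:R - (cv e == t)%:R))%R.

Lemma chunk_imbalance_earlier t t' x y :
  t' < t -> y \subset forward t ->
  chunk_imbalance t' (symdiff x y) = chunk_imbalance t' x.
Proof.
move=> lt_t /subsetP yF; apply: eq_bigr => e _; rewrite inE.
case ey: (e \in y); last by rewrite addbF.
move: (yF e ey); rewrite inE => /andP[_ /eqP min_t].
have -> : (cu e == t') = false by lia.
have -> : (cv e == t') = false by lia.
by rewrite subrr !mulr0.
Qed.

(** Exactly one end of each pair of [K] lies in chunk [t], so the pair contributes 1 or -1. [P]
    collects the contributions -1 under [x]; after flipping [y] they form [symdiff y P]. *)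
Lemma chunk_imbalance_flip t x (K : {set E}) : K \subset forward t ->
  exists (A : int) (P : {set E}), P \subset K /\ forall y, y \subset K ->
    chunk_imbalance t (symdiff x y) = (A - (2 * #|symdiff y P|)%:Z)%R.
Proof.
move=> /subsetP KF.
pose P := [set e in K | (e \in x) (+) (cu e != t)].
exists ((\sum_(e | e \notin K) (-1) ^+ (e \in x) * ((cu e == t)%:R - (cv e == t)%:R))
        + #|K|%:Z)%R, P.
have PK : P \subset K by apply/subsetP => e; rewrite inE => /andP[].
split=> // y yK; rewrite /chunk_imbalance (bigID (mem K)) /= addrC -addrA; congr (_ + _)%R.
  apply: eq_bigr => e eK; rewrite inE.
  case ey: (e \in y); last by rewrite addbF.
  by move: eK; rewrite /= (subsetP yK e ey).
have zK : symdiff y P \subset K by rewrite subset_symdiff.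
transitivity (\sum_(e in K) (1 - (2 * (e \in symdiff y P))%:Z))%R.
  apply: eq_bigr => e eK; move: (KF e eK); rewrite !inE eK => /andP[neq /eqP min_t].
  have [[-> ->]|[-> ->]] : (((cu e == t)%:R - (cv e == t)%:R)%R = (1%R : int) /\ (cu e != t) = false)
     \/ (((cu e == t)%:R - (cv e == t)%:R)%R = ((-1)%R : int) /\ (cu e != t)).
    case: (eqVneq (cu e) t) => [cut|cut]; [left|right].
      by have -> : (cv e == t) = false by lia.
    by have -> : (cv e == t) by lia.
  - by case: (e \in x); case: (e \in y).
  - by case: (e \in x); case: (e \in y).
rewrite sumrB sumr_const natz; congr (_ - _)%R.
rewrite -sum1_card PoszM -[X in (_ * X)%R]natz natr_sum mulr_sumr.
rewrite [RHS]big_mkcond [LHS]big_mkcond /=; apply: eq_bigr => e _.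
case ez: (e \in symdiff y P); first by rewrite (subsetP zK e ez).
by case: (e \in K).
Qed.

(** The imbalance is [A - 2 j] with [j] the size of a uniform subset of [K], so the window leaves at
    most [2 D] values of [j], each of probability at most that of the central one. *)
Lemma chunk_imbalance_small t x (K : {set E}) (h D : nat) :
    K \subset forward t -> #|K| = h.*2 -> 16 * D ^ 2 <= h.*2.+1 ->
  2 * #|[set y in powerset K | `|chunk_imbalance t (symdiff x y)|%N < 2 * D]|
    <= 2 ^ #|K|.
Proof.
move=> KF cardK hD; have [A [P [PK flipE]]] := chunk_imbalance_flip x KF.
pose Q j := (`|(A - (2 * j)%:Z)%R|%N < 2 * D).
apply: (@leq_trans (2 * (2 * D * 'C(h.*2, h)))); last first.
  have -> : 2 ^ #|K| = 4 ^ h by rewrite cardK -mul2n expnM.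
  (* After squaring, the factor [2 * (2 * D)] becomes [16 * D ^ 2], which [bin_central_sqr]
     absorbs. *)
  rewrite -leq_sqr -[leqRHS]expnM [h * 2]mulnC [4 ^ _]expnM.
  apply: leq_trans (bin_central_sqr h).
  rewrite (_ : (_ * _) ^ 2 = 'C(h.*2, h) ^ 2 * (16 * D ^ 2)).
    by rewrite leq_mul2l hD orbT.
  by rewrite !expnMn; lia.
rewrite leq_mul2l /=.
have Qclose i j : Q i -> Q j -> j < i + 2 * D by rewrite /Q; lia.
apply: leq_trans (card_pow_window cardK Qclose).
rewrite -(card_imset _ (inv_inj (symdiffK P))).
apply/subset_leq_card/subsetP => y; rewrite !inE => /andP[yK yD].
apply/imsetP; exists (symdiff y P); last by rewrite symdiffK.
by rewrite !inE subset_symdiff // yK /Q -flipE.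
Qed.

Definition wide (h q : nat) := [seq t <- iota 0 q | h.*2 <= #|forward t|].

Lemma card_all_small (h D q : nat) : 16 * D ^ 2 <= h.*2.+1 ->
  #|[pred x | all (fun t => `|chunk_imbalance t x|%N < 2 * D) (wide h q)]|
    * 2 ^ size (wide h q) <= 2 ^ #|E|.
Proof.
(* Each block is trimmed to exactly [2 h] pairs, the size for which the central binomial bound is
   stated. *)
move=> hD; pose K t := [set e in take h.*2 (enum (forward t))].
have KF t : K t \subset forward t.
  by apply/subsetP => e; rewrite inE => /mem_take; rewrite mem_enum.
apply: (@card_triangular E K (fun t x => `|chunk_imbalance t x|%N < 2 * D)).
- by apply: sorted_filter; [exact: ltn_trans | exact: iota_ltn_sorted].
- by move=> t t' x y lt_t yK; rewrite (chunk_imbalance_earlier _ lt_t) // (subset_trans yK).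
- move=> t x; rewrite mem_filter => /andP[wide_t _].
  apply: (@chunk_imbalance_small t x (K t) h) => //.
  rewrite cardsE (card_uniqP _) ?take_uniq ?enum_uniq //.
  by rewrite size_take -cardE; case: ltnP; lia.
Qed.

(** A crossing pair is counted at its earlier chunk: wide chunks carry at most [M] of them, the
    others fewer than [2 h]. Hence many crossing pairs force many wide chunks. *)
Lemma card_crossing_wide (h q M : nat) :
    (forall e, minn (cu e) (cv e) < q) -> (forall t, #|forward t| <= M) ->
  #|[pred e | cu e != cv e]| <= size (wide h q) * M + q * h.*2.
Proof.
move=> lt_q FM.
rewrite -sum1_card (partition_big (fun e => inord (minn (cu e) (cv e)) : 'I_q.-1.+1) predT) //=.
have q0 e : 0 < q by apply: leq_ltn_trans (lt_q e).
apply: (@leq_trans (\sum_(t < q.-1.+1 | t < q) ((h.*2 <= #|forward t|) * M + h.*2))).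
  rewrite [leqRHS]big_mkcond; apply: leq_sum => t _ /=.
  have sub : \sum_(e | (cu e != cv e) && (inord (minn (cu e) (cv e)) == t)) 1
     <= (t < q) * #|forward t|.
    rewrite sum1_card; case: ltnP => [lt_tq|le_qt]; last first.
      rewrite mul0n leqn0; apply/eqP/eq_card0 => e; move: (q0 e) (ltn_ord t) => q0e lt_tq; lia.
    rewrite mul1n; apply/subset_leq_card/subsetP => e; rewrite unfold_in inE => /andP[-> /eqP <-] /=.
    by rewrite inordK ?eqxx // prednK ?lt_q ?(q0 e).
  apply: leq_trans sub _; case: ltnP => // _; rewrite mul1n.
  by case: leqP (FM t); lia.
rewrite big_split /= sum_nat_const leq_add //.
  rewrite -big_distrl leq_mul2r; apply/orP; right.
  rewrite size_filter -sum1_count big_mkcond [leqRHS](_ : _ = \sum_(t <- index_iota 0 q | h.*2 <= #|forward t|) 1).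
    rewrite big_mkord [leqRHS]big_mkcond /=.
    case: q lt_q q0 => [|q] lt_q _; first by rewrite big1 // => i _; rewrite ltn0.
    by apply: leq_sum => i _; rewrite (ltn_ord i); case: ifP.
  by rewrite /index_iota subn0.
rewrite leq_mul2r; apply/orP; right.
case: q {lt_q q0} => [|q]; first by rewrite eq_card0 // => i; rewrite unfold_in ltn0.
by rewrite (leq_trans (max_card _)) ?card_ord.
Qed.

End Chunks.

(** * Orders unbalanced by a common shift and orientation *)

(** The union bound. *)
Lemma exists_avoiding (T : finType) (A : Type) (bad : A -> pred T) (s : seq A) :
  \sum_(a <- s) #|bad a| < #|T| -> exists x, all (fun a => ~~ bad a x) s.
Proof.
move=> lt_s; apply/existsP; apply: contraLR lt_s => /existsPn allbad; rewrite -leqNgt.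
have -> : #|T| = #|[pred x | has (bad^~ x) s]|.
  by apply/esym/eq_card => x; rewrite !inE -[has _ _]negbK -all_predC allbad.
elim: s {allbad} => [|a s IHs]; first by rewrite eq_card0.
rewrite big_cons /=; apply: leq_trans (leq_add (leqnn _) IHs).
by rewrite -cardUI (leq_trans _ (leq_addr _ _)) //; apply/subset_leq_card/subsetP => x.
Qed.

Lemma card_chunk_fiber (T : finType) m (f : T -> 'I_m) C t :
  injective f -> 0 < C -> #|[pred x | f x %/ C == t]| <= C.
Proof.
move=> injf C0; rewrite -(card_image injf).
have closeP i j : i %/ C == t -> j %/ C == t -> j < i + C.
  by move=> /eqP<- /eqP; lia.
apply: leq_trans (@card_window m C (fun i => i %/ C == t) closeP).
by apply/subset_leq_card/subsetP => y /imageP[x xt ->].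
Qed.

(* Double counting: every pair [(i, j)] is matched by exactly one shift. *)
Lemma card_bad_shifts b m (u v : 'I_b.+1 -> 'I_m) C :
    injective v -> 0 < C ->
  #|[pred k : 'I_b.+1 | b.+1 <= 2 * #|[pred i | u i %/ C == v (i + k)%R %/ C]|]| <= 2 * C.
Proof.
move=> injv C0; set B := [pred k | _].
rewrite -(@leq_pmul2r b.+1) // -sum_nat_const.
apply: (@leq_trans (\sum_k 2 * #|[pred i | u i %/ C == v (i + k)%R %/ C]|)).
  rewrite big_mkcond /=; apply: leq_sum => k _.
  by case: ifP => // kB; apply: kB.
rewrite -big_distrr -mulnA leq_mul2l /=.
apply: (@leq_trans (\sum_(i < b.+1) C)); last by rewrite sum_nat_const card_ord mulnC.
apply: (@leq_trans (\sum_(k < b.+1) \sum_(i < b.+1) (u i %/ C == v (i + k)%R %/ C : nat))).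
  by apply: leq_sum => k _; rewrite -sum1_card big_mkcond.
rewrite exchange_big; apply: leq_sum => i _.
apply: (@leq_trans #|[pred j | v j %/ C == u i %/ C]|); last exact: card_chunk_fiber.
rewrite -sum1_card [leqRHS]big_mkcond [leqRHS](reindex_inj (addrI i)) /=.
by apply: leq_sum => k _; rewrite inE eq_sym; case: eqP.
Qed.

(** * From balanced prefixes to balanced chunks *)

Section Orders.

Variables (E : finType) (m : nat) (U V : E -> 'I_m).

(** Here [p] sends a part to its reading position, so it is the inverse of the permutation of a
    program. A sign -1 exchanges the owners of the two ends; the sum compares the ends of the two
    players among the first [l] parts read. *)
Definition prefix_imbalance (p : 'S_m) (l : nat) (x : {set E}) : int :=
  (\sum_e (-1) ^+ (e \in x) * ((p (U e) < l)%N%:R - (p (V e) < l)%N%:R))%R.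

Definition balanced (p : 'S_m) (D : nat) (x : {set E}) :=
  [forall l : 'I_m.+1, `|prefix_imbalance p l x|%N < D].

Lemma chunk_imbalance_prefix (p : 'S_m) C t x : 0 < C ->
  chunk_imbalance (fun e => p (U e) %/ C) (fun e => p (V e) %/ C) t x
    = (prefix_imbalance p (minn (t.+1 * C) m) x - prefix_imbalance p (minn (t * C) m) x)%R.
Proof.
move=> C0; rewrite -sumrB; apply: eq_bigr => e _; rewrite -mulrBr; congr (_ * _)%R.
have divE (j : 'I_m) : ((j %/ C == t)%N%:R : int)%R =
    ((j < minn (t.+1 * C) m)%N%:R - (j < minn (t * C) m)%N%:R)%R.
  rewrite !ltn_min ltn_ord !andbT -!ltn_divLR // eqn_leq ltnS leqNgt andbC.
  by case: ltnP; case: ltnP => //; lia.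
by rewrite !divE; ring.
Qed.

(** A chunk is a difference of two prefixes, so balance up to [D] keeps every chunk below [2 * D].
    With [w] the number of wide chunks, each of them halves the count of such patterns. *)
Lemma card_balanced (p : 'S_m) (C D h : nat) :
    injective U -> injective V -> 0 < C -> 16 * D ^ 2 <= h.*2.+1 ->
  exists w, #|balanced p D| * 2 ^ w <= 2 ^ #|E| /\
    #|[pred e | p (U e) %/ C != p (V e) %/ C]| <= w * (2 * C) + (m %/ C).+1 * h.*2.
Proof.
move=> injU injV C0 hD.
pose cu e := p (U e) %/ C; pose cv e := p (V e) %/ C.
exists (size (wide cu cv h (m %/ C).+1)); split.
  apply: leq_trans (card_all_small cu cv (m %/ C).+1 hD).
  rewrite leq_mul2r; apply/orP; right; apply/subset_leq_card/subsetP => x /forallP bal.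
  apply/allP => t _; rewrite chunk_imbalance_prefix //.
  have bal' l : `|prefix_imbalance p (minn l m) x|%N < D.
    have lt_m : minn l m < m.+1 by rewrite ltnS geq_minr.
    exact: (bal (Ordinal lt_m)).
  by move: (bal' (t.+1 * C)) (bal' (t * C)); lia.
apply: card_crossing_wide => [e|t].
  by rewrite ltnS geq_min leq_div2r // ltnW.
(* A pair of [forward t] has an end in chunk [t], which contains at most [C] ends of either kind;
   hence the factor [2 * C]. *)
have fib (f : E -> 'I_m) : injective f -> #|[set e | p (f e) %/ C == t]| <= C.
  move=> injf; rewrite cardsE; apply: card_chunk_fiber => //.
  exact: inj_comp perm_inj injf.
rewrite mul2n -addnn; apply: leq_trans (leq_add (fib U injU) (fib V injV)).
rewrite -cardsUI (leq_trans _ (leq_addr _ _)) //.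
apply/subset_leq_card/subsetP => e; rewrite !inE /minn /cu /cv => /andP[_].
by case: ltnP => _ ->; rewrite ?orbT.
Qed.

End Orders.

(** Addition in ['I_b.+1] is cyclic, so each group is permuted by a rotation. *)
Definition shift_edge r b (k : {ffun 'I_r -> 'I_b.+1}) (e : 'I_r * 'I_b.+1) :=
  (e.1, (e.2 + k e.1)%R).

Lemma shift_edge_inj r b (k : {ffun 'I_r -> 'I_b.+1}) : injective (shift_edge k).
Proof. by move=> [g i] [g' i']; rewrite /shift_edge => /pair_equal_spec[/= <- /addIr <-]. Qed.

(** Two union bounds in succession: the first over the shifts, giving every order a group with
    mostly crossing pairs, the second over the orientations for these fixed shifts. *)
Lemma exists_unbalanced z m (ps : seq 'S_m) (U V : 'I_z * 'I_(z ^ 10).+1 -> 'I_m) :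
    injective U -> injective V -> 16 <= z -> m < 5 * z.+1 ^ 11 -> size ps < 2 ^ z ->
  exists k, exists x, all (fun p => ~~ balanced U (V \o shift_edge k) p z x) ps.
Proof.
(* [C] must satisfy [4 * C <= z ^ 10] for the first union bound, yet be so large that the [O(z ^ 6)]
   chunks with [O(z ^ 2)] pairs each cannot hold half of a group. *)
move=> injU injV z16 m_lt lt_ps; pose C := z ^ 8.
have C0 : 0 < C by rewrite expn_gt0; lia.
pose bad_shift (p : 'S_m) g (k : 'I_(z ^ 10).+1) :=
  (z ^ 10).+1 <= 2 * #|[pred i | p (U (g, i)) %/ C == p (V (g, i + k)%R) %/ C]|.
have [k okk] : exists k : {ffun 'I_z -> 'I_(z ^ 10).+1},
    all (fun p => ~~ [forall g, bad_shift p g (k g)]) ps.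
  apply: exists_avoiding.
  apply: (@leq_ltn_trans (\sum_(p <- ps) (2 * C) ^ z)).
    apply: leq_sum => p _.
    have -> : #|[pred k : {ffun 'I_z -> 'I_(z ^ 10).+1} | [forall g, bad_shift p g (k g)]]|
        = #|family (bad_shift p)| by apply: eq_card.
    rewrite card_family foldrE big_map big_enum /=.
    (* The shifts of the groups are independent, so the bad tuples form a product of sets of size at
       most [2 * C]. *)
    rewrite -[in leqRHS](card_ord z) -prod_nat_const; apply: leq_prod => g _.
    apply: (@card_bad_shifts _ _ (fun i => p (U (g, i))) (fun j => p (V (g, j)))) => //.
    by move=> i j /perm_inj/injV[].
  rewrite big_const_seq count_predT iter_addn_0 card_ffun !card_ord.
  apply: (@leq_trans (2 ^ z * (2 * C) ^ z)).
    by rewrite [X in X < _]mulnC ltn_pmul2r // expn_gt0; lia.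
  rewrite -expnMn leq_exp2r; last by lia.
  rewrite /C; have -> : z ^ 10 = z ^ 2 * z ^ 8 by rewrite -expnD.
  have : 4 <= z ^ 2 by rewrite (leq_trans _ (leq_pexp2l _ (isT : 1 <= 2))) ?expn1; lia.
  by nia.
exists k; apply: exists_avoiding.
have injVk : injective (V \o shift_edge k) by apply: inj_comp injV (@shift_edge_inj _ _ k).
have card_bal p : p \in ps -> #|balanced U (V \o shift_edge k) p z| * 2 ^ z <= 2 ^ #|{: 'I_z * 'I_(z ^ 10).+1}|.
  move=> pps; have hD : 16 * z ^ 2 <= (8 * z ^ 2).*2.+1 by lia.
  have [w [bal_w cross_w]] := card_balanced p injU injVk C0 hD.
  apply: leq_trans bal_w; rewrite leq_mul2l; apply/orP; right; rewrite leq_exp2l //.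
  (* If [w < z], few pairs cross; but a good group [g] alone has more than half of its [z ^ 10 + 1]
     pairs crossing. *)
  rewrite leqNgt; apply/negP => lt_wz.
  have /forallPn[g] := allP okk p pps; rewrite /bad_shift -ltnNge => good.
  set same := [pred i | _] in good.
  have : #|[predC same]| <= w * (2 * C) + (m %/ C).+1 * (8 * z ^ 2).*2.
    apply: leq_trans cross_w; have injg : injective (fun i : 'I_(z ^ 10).+1 => (g, i)) by move=> i j [].
    rewrite -(card_image injg); apply/subset_leq_card/subsetP => e /imageP[i ip ->].
    by rewrite !inE in ip *.
  have := cardC same; rewrite card_ord => cardE le_cross.
  have lt_b : (z ^ 10).+1 < 2 * (w * (2 * C) + (m %/ C).+1 * (8 * z ^ 2).*2).
    have half a c x B : 2 * a < B -> a + c = B -> c <= x -> B < 2 * x by lia.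
    exact: half good cardE le_cross.
  have le_q : m %/ C <= 5 * z ^ 6.
    rewrite -ltnS ltn_divLR // (leq_trans m_lt) //.
    apply: (@leq_trans (5 * (2 * z) ^ 11)).
      by rewrite leq_mul2l leq_exp2r //; lia.
    have z_big : 2 ^ 11 <= z ^ 3.
      apply: (@leq_trans (16 ^ 3)); last by rewrite leq_exp2r.
      by rewrite -[16]/(2 ^ 4) -expnM leq_pexp2l.
    rewrite expnMn /C; have -> : z ^ 11 = z ^ 3 * z ^ 8 by rewrite -expnD.
    have -> : z ^ 6 = z ^ 3 * z ^ 3 by rewrite -expnD.
    move: (2 ^ 11) (z ^ 3) (z ^ 8) z_big => c a d le_ca.
    apply: (@leq_trans (5 * (a * (a * d)))).
      by rewrite !leq_mul2l leq_mul2r le_ca !orbT.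
    by rewrite (mulSn (5 * _)) !mulnA leq_addl.
  have {le_q lt_b} : (z ^ 10).+1 < 2 * (z * (2 * C) + (5 * z ^ 6).+1 * (8 * z ^ 2).*2).
    apply: leq_trans lt_b _; rewrite leq_mul2l leq_add //.
      by rewrite leq_mul2r ltnW ?orbT.
    by rewrite leq_mul2r ltnS le_q orbT.
  apply/negP; rewrite -leqNgt; apply: leqW.
  apply: (@leq_trans (4 * z ^ 9 + 192 * z ^ 8)).
    rewrite mulnDr /C; have -> : 2 * (z * (2 * z ^ 8)) = 4 * z ^ 9 by rewrite [z ^ 9]expnS; lia.
    rewrite leq_add2l; have -> : z ^ 8 = z ^ 6 * z ^ 2 by rewrite -expnD.
    have : z ^ 2 <= z ^ 6 * z ^ 2 by rewrite leq_pmull // expn_gt0; lia.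
    by move: (z ^ 6) (z ^ 2) => a c; lia.
  have -> : z ^ 9 = z * z ^ 8 by rewrite -expnS.
  have -> : z ^ 10 = z * z * z ^ 8 by rewrite -mulnA -!expnS.
  rewrite mulnA -mulnDl leq_mul2r; apply/orP; right.
  (* What remains is [4 * z + 192 <= z * z], where [z >= 16] is used as [192 <= 12 * z]. *)
  by have : 16 * z <= z * z by [rewrite leq_mul2r z16 orbT]; lia.
rewrite -(@ltn_pmul2r (2 ^ z)) ?expn_gt0 // big_distrl /=.
apply: (@leq_ltn_trans (\sum_(p <- ps) 2 ^ #|{: 'I_z * 'I_(z ^ 10).+1}|)).
  by rewrite !big_seq; apply: leq_sum.
rewrite big_const_seq count_predT iter_addn_0 -cardsT -[_ ^ _]card_powerset.
rewrite [#|powerset _|](_ : _ = #|{set 'I_z * 'I_(z ^ 10).+1}|); last by rewrite powersetT cardsT.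
rewrite ltn_pmul2l // -cardsT -powersetT card_powerset expn_gt0 //.
Qed.

Local Open Scope ring_scope.

(** * Rank of ordered branching programs *)

Section Rank.

Variable F : fieldType.

Lemma rank_sum_rank1 (m n : nat) (I : finType) (P : pred I)
    (f : I -> 'cV[F]_m) (g : I -> 'rV[F]_n) :
  (\rank (\sum_(i | P i) f i *m g i)%R <= #|P|)%N.
Proof.
rewrite -sum1_card.
elim/big_ind2: _ => [|a x b y ax by_|i _]; first by rewrite mxrank0.
  by apply: leq_trans (mxrank_add _ _) (leq_add ax by_).
exact: mulmx_max_rank.
Qed.

Definition fun_mx (X : finType) (Phi : X -> X -> F) : 'M[F]_#|X| :=
  \matrix_(i, j) Phi (enum_val i) (enum_val j).

Lemma fun_mx_id (X : finType) : fun_mx (fun x y : X => (x == y)%:R) = 1%:M.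
Proof. by apply/matrixP => i j; rewrite !mxE (inj_eq enum_val_inj). Qed.

(* The two factors only share the coordinates of [b] in [J1] and those of [a]
   in [J2]; fixing these makes every product a rank-one matrix. *)
Lemma rank_sum_split (E : finType) (w : nat) (f g : 'I_w -> {set E} -> {set E} -> F)
    (J1 J2 : {set E}) :
    (forall v a b, f v a b = f v a (b :&: J1)) ->
    (forall v a b, g v a b = g v (a :&: J2) b) ->
  (\rank (fun_mx (fun a b => (\sum_v f v a b * g v a b)%R)) <= w * 2 ^ (#|J1| + #|J2|))%N.
Proof.
move=> fJ gJ.
pose P := [pred i : 'I_w * ({set E} * {set E}) | (i.2.1 \in powerset J1) && (i.2.2 \in powerset J2)].
have cardP : #|P| = (w * 2 ^ (#|J1| + #|J2|))%N.
  transitivity #|setX [set: 'I_w] (setX (powerset J1) (powerset J2))|.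
    by apply: eq_card => -[v [a b]]; rewrite !inE.
  by rewrite !cardsX cardsT card_ord !card_powerset expnD.
rewrite -cardP.
pose cl (i : 'I_w * ({set E} * {set E})) : 'cV[F]_#|{set E}| :=
  \col_k (f i.1 (enum_val k) i.2.1 * (enum_val k :&: J2 == i.2.2)%:R).
pose rw (i : 'I_w * ({set E} * {set E})) : 'rV[F]_#|{set E}| :=
  \row_k ((enum_val k :&: J1 == i.2.1)%:R * g i.1 i.2.2 (enum_val k)).
apply: leq_trans (rank_sum_rank1 P cl rw); rewrite leq_eqVlt; apply/orP; left; apply/eqP.
congr (\rank _); apply/matrixP => i j; rewrite summxE !mxE.
set a := enum_val i; set b := enum_val j.
transitivity (\sum_(v < w) \sum_(ab | (ab.1 \in powerset J1) && (ab.2 \in powerset J2))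
    f v a ab.1 * (a :&: J2 == ab.2)%:R * ((b :&: J1 == ab.1)%:R * g v ab.2 b)).
  apply: eq_bigr => v _.
  rewrite (bigD1 (b :&: J1, a :&: J2)) /=; last by rewrite !inE !subsetIr.
  rewrite !eqxx mulr1 mul1r -fJ -gJ big1 ?addr0 // => -[a' b'] /andP[_].
  rewrite xpair_eqE negb_and ![_ == _ :&: _]eq_sym => /orP[] /negbTE /= ->.
    by rewrite mul0r mulr0.
  by rewrite mulr0 mul0r.
rewrite pair_big_dep /=; apply: eq_big => -[v [a' b']] //= _.
by rewrite !mxE big_ord1 !mxE.
Qed.

End Rank.

(** * Cutting an ordered program at a layer *)

Section Cut.

Variables (F : fieldType) (N m : nat) (part : 'I_N -> 'I_m) (A : smABP F N m part).

Lemma meval_label l u v (pt pt' : 'I_N -> F) :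
    (forall x, part x = sm_sigma A l -> pt x = pt' x) ->
  (sm_lab A l u v).@[pt] = (sm_lab A l u v).@[pt'].
Proof.
move=> eq_pt; have [c ->] := sm_lin _ _ _ _ A l u v.
rewrite !raddf_sum; apply: eq_bigr => x /eqP px /=.
by rewrite !mevalZ !mevalXU eq_pt.
Qed.

Local Notation path := {dffun forall l : 'I_m.+1, 'I_(sm_lw A l)}.

(** Paths are sorted by their node [v] in layer [l]; [f v] and [g v] sum over the halves before and
    after it. The labels of a half only involve parts read on its side. *)
Lemma sm_poly_cut (l : 'I_m.+1) :
  exists f g : 'I_(sm_lw A l) -> ('I_N -> F) -> F,
  [/\ forall pt, (sm_poly A).@[pt] = \sum_v f v pt * g v pt,
      forall v pt pt', (forall x, ((sm_sigma A)^-1%g (part x) < l)%N -> pt x = pt' x) ->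
        f v pt = f v pt' &
      forall v pt pt', (forall x, (l <= (sm_sigma A)^-1%g (part x))%N -> pt x = pt' x) ->
        g v pt = g v pt'].
Proof.
(* An empty layer leaves no path and the zero polynomial; otherwise [p0] serves as filler. *)
case: (pickP [pred p : path | true]) => [p0 _|nopath]; last first.
  exists (fun _ _ => 0), (fun _ _ => 0); split=> // pt.
  rewrite /sm_poly big1 ?raddf0 ?big1 // => [v _|p _]; first by rewrite mul0r.
  by have := nopath p.
(* Half-paths are encoded as full paths that agree with [p0] beyond the cut, which avoids a separate
   type of partial paths. *)
pose before (p : path) := [forall k : 'I_m.+1, (l < k)%N ==> (p k == p0 k)].
pose after (p : path) := [forall k : 'I_m.+1, (k < l)%N ==> (p k == p0 k)].
pose pre (p : path) pt := \prod_(k < m | (k < l)%N) (sm_lab A k (p (lo k)) (p (hi k))).@[pt].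
pose post (p : path) pt := \prod_(k < m | ~~ (k < l)%N) (sm_lab A k (p (lo k)) (p (hi k))).@[pt].
exists (fun v pt => \sum_(p : path | (p l == v) && before p) pre p pt),
       (fun v pt => \sum_(p : path | (p l == v) && after p) post p pt); split.
- move=> pt; rewrite raddf_sum /=.
  rewrite (partition_big (fun p : path => p l) predT) //=; apply: eq_bigr => v _.
  rewrite big_distrlr pair_big /=.
  pose join (pp : path * path) : path :=
    [ffun k : 'I_m.+1 => if (k <= l)%N then pp.1 k else pp.2 k].
  pose split (p : path) : path * path :=
    ([ffun k : 'I_m.+1 => if (k <= l)%N then p k else p0 k],
     [ffun k : 'I_m.+1 => if (k < l)%N then p0 k else p k]).
  rewrite (reindex_onto join split) /=; last first.
    move=> p _; apply/ffunP => k; rewrite !ffunE /=.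
    by case: (ltngtP k l).
  apply: eq_big => [[p1 p2]|[p1 p2]] /=.
    rewrite ffunE leqnn xpair_eqE; apply/andP/andP => [[/eqP <- /andP[/eqP E1 /eqP E2]]|].
      split; apply/andP; split=> //.
      + by apply/forallP => k; apply/implyP => lt_lk; rewrite -E1 !ffunE leqNgt lt_lk.
      + by rewrite -[in X in X == _]E2 !ffunE ltnn /= leqnn.
      + by apply/forallP => k; apply/implyP => lt_kl; rewrite -E2 !ffunE lt_kl.
    case=> /andP[/eqP p1l /forallP be] /andP[/eqP p2l /forallP af]; split; first exact/eqP.
    apply/andP; split; apply/eqP/ffunP => k; rewrite !ffunE /=.
      by case: leqP => // lt_lk; apply/esym/eqP/(implyP (be k)).
    case: ltnP => [lt_kl|le_lk]; first by apply/esym/eqP/(implyP (af k)).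
    case: leqP => // le_kl.
    have -> : k = l by apply/val_inj/eqP; rewrite /= eqn_leq le_kl.
    by rewrite p1l p2l.
  case/andP => /eqP jl /eqP jK.
  rewrite rmorph_prod (bigID (fun k : 'I_m => (k < l)%N)) /=; congr (_ * _).
    apply: eq_bigr => k lt_kl; rewrite !ffunE /=.
    by rewrite [(lo k <= l)%N]ltnW // [(hi k <= l)%N]lt_kl.
  apply: eq_bigr => k; rewrite -leqNgt => le_lk; rewrite !ffunE /=.
  rewrite [(hi k <= l)%N]leqNgt /= ltnS le_lk /=.
  (* In the cut layer itself [join] takes the node of the first half, while [post] uses that of the
     second; both are [v]. *)
  case: leqP => // le_kl; have lo_k : lo k = l by apply/val_inj/eqP; rewrite /= eqn_leq le_kl.
  congr (meval _ (sm_lab A _ _ _)).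
  move: jK => [_ E2]; rewrite -E2 !ffunE /=.
  by rewrite ltnNge le_lk /= le_kl.
- move=> v pt pt' eq_pt; apply: eq_bigr => p _; apply: eq_bigr => k lt_kl.
  by apply: meval_label => x px; apply: eq_pt; rewrite px permK.
move=> v pt pt' eq_pt; apply: eq_bigr => p _; apply: eq_bigr => k; rewrite -leqNgt => le_lk.
by apply: meval_label => x px; apply: eq_pt; rewrite px permK.
Qed.

End Cut.

(** * Rank of evaluation matrices and total width *)

Section LowerBound.

Variables (F : fieldType) (N m : nat) (part : 'I_N -> 'I_m) (E : finType).
Implicit Types (A : smABP F N m part) (a b : {set E}) (pt : {set E} -> {set E} -> 'I_N -> F).

(** The row player, holding [a], controls the parts [y e], and the column player, holding [b], the
    parts [z e]; variables of other parts are constant. *)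
Definition reads (y z : E -> 'I_m) pt := forall a b a' b' x,
  (forall e, y e = part x -> (e \in a) = (e \in a')) ->
  (forall e, z e = part x -> (e \in b) = (e \in b')) -> pt a b x = pt a' b' x.

Definition eval_mx pt (P : {mpoly F[N]}) : 'M[F]_#|{set E}| := fun_mx (fun a b => P.@[pt a b]).

(** Before the cut only the column parts read there see [b], and after it only the row parts read
    there see [a]; these are the shared coordinates of [rank_sum_split]. *)
Lemma rank_eval_mx A (l : 'I_m.+1) (y z : E -> 'I_m) pt : reads y z pt ->
  (\rank (eval_mx pt (sm_poly A)) <= sm_lw A l *
     2 ^ (#|[set e | ((sm_sigma A)^-1%g (z e) < l)%N]|
          + #|[set e | ~~ ((sm_sigma A)^-1%g (y e) < l)%N]|))%N.
Proof.
move=> rd; have [f [g [fgE fl gl]]] := sm_poly_cut A l.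
rewrite (_ : eval_mx _ _ = fun_mx (fun a b => \sum_v f v (pt a b) * g v (pt a b))); last first.
  by apply/matrixP => i j; rewrite !mxE fgE.
apply: (@rank_sum_split F E _ (fun v a b => f v (pt a b)) (fun v a b => g v (pt a b))).
  move=> v a b; apply: fl => x lt_xl; apply: rd => // e ze.
  by rewrite !inE ze lt_xl andbT.
move=> v a b; apply: gl => x le_lx; apply: rd => // e ye.
by rewrite !inE ye -leqNgt le_lx andbT.
Qed.

Lemma rank_eval_mx_swap pt P :
  \rank (eval_mx pt P) = \rank (eval_mx (fun a b => pt b a) P).
Proof. by rewrite -mxrank_tr; congr (\rank _); apply/matrixP => i j; rewrite !mxE. Qed.

Variables (U V : E -> 'I_m) (x : {set E}).

Let Y e := if e \in x then V e else U e.
Let Z e := if e \in x then U e else V e.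

Lemma prefix_imbalance_card (p : 'S_m) l :
  prefix_imbalance U V p l x = #|[set e | (p (Y e) < l)%N]|%:Z - #|[set e | (p (Z e) < l)%N]|%:Z.
Proof.
rewrite -!sum1_card !(big_mkcond (mem [set _ | _])) /= -!natz !natr_sum -sumrB.
apply: eq_bigr => e _; rewrite !inE /Y /Z; case: (e \in x).
  by rewrite mulN1r opprB; case: (p _ < l)%N; case: (p _ < l)%N.
by rewrite mul1r; case: (p _ < l)%N; case: (p _ < l)%N.
Qed.

(** The exponent in [rank_eval_mx] is [#|E|] minus the excess of row over column parts before the
    cut. An excess in the other direction is handled by transposing the matrix. *)
Lemma rank_unbalanced A D pt : reads Y Z pt -> ~~ balanced U V (sm_sigma A)^-1%g D x ->
  (\rank (eval_mx pt (sm_poly A)) * 2 ^ D <= sm_width A * 2 ^ #|E|)%N.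
Proof.
move=> rd /forallPn[l]; rewrite -leqNgt prefix_imbalance_card => le_D.
have wl : (sm_lw A l <= sm_width A)%N by apply: (leq_bigmax l).
set p := (sm_sigma A)^-1%g in le_D.
have cardN (f : E -> 'I_m) : (#|[set e | (p (f e) < l)%N]| + #|[set e | ~~ (p (f e) < l)%N]| = #|E|)%N.
  by rewrite -(cardsC [set e | (p (f e) < l)%N]); congr (_ + #|pred_of_set _|)%N; apply/setP => e; rewrite !inE.
have key (y z : E -> 'I_m) r :
    (r <= sm_lw A l * 2 ^ (#|[set e | (p (z e) < l)%N]| + #|[set e | ~~ (p (y e) < l)%N]|))%N ->
    (D + #|[set e | (p (z e) < l)%N]| <= #|[set e | (p (y e) < l)%N]|)%N ->
    (r * 2 ^ D <= sm_width A * 2 ^ #|E|)%N.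
  move=> le_r le_yz; apply: (@leq_trans (sm_lw A l *
     2 ^ (#|[set e | (p (z e) < l)%N]| + #|[set e | ~~ (p (y e) < l)%N]|) * 2 ^ D)).
    by rewrite leq_mul2r le_r orbT.
  rewrite -mulnA -expnD leq_mul // leq_exp2l //.
  by rewrite addnC addnA -(cardN y) leq_add2r.
have [le_D1|le_D2] : (D + #|[set e | (p (Z e) < l)%N]| <= #|[set e | (p (Y e) < l)%N]|)%N
    \/ (D + #|[set e | (p (Y e) < l)%N]| <= #|[set e | (p (Z e) < l)%N]|)%N.
- by move: #|[set e | _]| #|[set e | _]| le_D => c d; lia.
- exact: key (rank_eval_mx A l rd) le_D1.
have rd' : reads Z Y (fun a b => pt b a) by move=> a b a' b' w Ha Hb; apply: rd.
by rewrite rank_eval_mx_swap; apply: key (rank_eval_mx A l rd') le_D2.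
Qed.

(** The matrix of [G] is the identity, of rank [2 ^ #|E|], and rank is subadditive over the programs
    in [s]. *)
Lemma total_width_unbalanced (s : seq (smABP F N m part)) (G : {mpoly F[N]}) D pt :
    reads Y Z pt -> sum_smABP_computes s G ->
    (forall a b, G.@[pt a b] = (a == b)%:R) ->
    all (fun p => ~~ balanced U V p D x) [seq (sm_sigma A)^-1%g | A <- s] ->
  (2 ^ D <= total_width s)%N.
Proof.
move=> rd sG GE unbal.
have rankG : \rank (eval_mx pt G) = (2 ^ #|E|)%N.
  rewrite (_ : eval_mx pt G = fun_mx (fun a b => (a == b)%:R)).
    by rewrite fun_mx_id mxrank1 -[LHS]cardsT -powersetT card_powerset cardsT.
  by apply/matrixP => i j; rewrite !mxE GE.
rewrite -(@leq_pmul2r (2 ^ #|E|)) ?expn_gt0 // [leqLHS]mulnC -[in leqLHS]rankG -sG.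
have -> : eval_mx pt (\sum_(A <- s) sm_poly A) = \sum_(A <- s) eval_mx pt (sm_poly A).
  by apply/matrixP => i j; rewrite mxE raddf_sum summxE /=; apply: eq_bigr => A _; rewrite mxE.
rewrite /total_width {sG}.
elim: s unbal => [|A s IHs] /=; first by rewrite !big_nil mxrank0.
case/andP=> unbalA /IHs{}IHs; rewrite !big_cons mulnDl.
apply: leq_trans (leq_add (rank_unbalanced rd unbalA) IHs).
by rewrite -mulnDl leq_mul2r mxrank_add orbT.
Qed.

End LowerBound.

(** * Branching programs from walks in a matrix product *)

Section Walks.

Variables (R : comNzRingType) (T : finType).
Implicit Types (ms : seq (T -> T -> R)) (x y z : T).

(** An entry of the product of the matrices [ms]. *)
Fixpoint walk ms x y : R :=
  if ms is M :: ms' then \sum_z M x z * walk ms' z y else (x == y)%:R.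

Lemma walk_cat ms1 ms2 x y :
  walk (ms1 ++ ms2) x y = \sum_z walk ms1 x z * walk ms2 z y.
Proof.
elim: ms1 x => [|M ms1 IHms] x /=.
  rewrite (bigD1 x) //= eqxx mul1r big1 ?addr0 // => z /negbTE nz.
  by rewrite eq_sym nz mul0r.
transitivity (\sum_w \sum_z M x w * (walk ms1 w z * walk ms2 z y)).
  by apply: eq_bigr => w _; rewrite IHms big_distrr.
rewrite exchange_big; apply: eq_bigr => z _.
by rewrite big_distrl; apply: eq_bigr => w _; rewrite mulrA.
Qed.

Lemma walk_sum ms x y :
  \sum_(q : {ffun 'I_(size ms).+1 -> T} | (q ord0 == x) && (q ord_max == y))
     \prod_(l < size ms) nth (fun _ _ => 0) ms l (q (lo l)) (q (hi l)) = walk ms x y.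
Proof.
elim: ms x => [|M ms IHms] x /=.
  have ord1_max : ord_max = ord0 :> 'I_1 by apply/val_inj.
  case: eqVneq => [<-|nxy].
    rewrite (big_pred1 [ffun=> x]) ?big_ord0 // => q; rewrite ord1_max andbb.
    apply/eqP/eqP => [q0|->]; last by rewrite ffunE.
    by apply/ffunP => i; rewrite ffunE ord1.
  rewrite big_pred0 // => q; rewrite ord1_max.
  by case: eqVneq => //= ->; apply: negbTE.
pose cons (zq : T * {ffun 'I_(size ms).+1 -> T}) : {ffun 'I_(size ms).+2 -> T} :=
  [ffun l => if unlift ord0 l is Some l' then zq.2 l' else zq.1].
pose uncons (q : {ffun 'I_(size ms).+2 -> T}) :=
  (q ord0, [ffun l : 'I_(size ms).+1 => q (lift ord0 l)]).
have cons0 zq : cons zq ord0 = zq.1 by rewrite ffunE unlift_none.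
have consS zq l : cons zq (lift ord0 l) = zq.2 l by rewrite ffunE liftK.
rewrite (reindex cons) /=; last first.
  exists uncons => [[z q] _|q _].
    by rewrite /uncons cons0; congr (_, _); apply/ffunP => l; rewrite ffunE consS.
  apply/ffunP => l; case: (unliftP ord0 l) => [l' ->|->].
    by rewrite consS ffunE.
  by rewrite cons0.
have max_lift : ord_max = lift ord0 ord_max :> 'I_(size ms).+2 by apply/val_inj.
transitivity (\sum_z \sum_(q : {ffun 'I_(size ms).+1 -> T} | (z == x) && (q ord_max == y))
    M z (q ord0) * \prod_(l < size ms) nth (fun _ _ => 0) ms l (q (lo l)) (q (hi l))).
  rewrite pair_big_dep /=; apply: eq_big => [[z q]|[z q] _].
    by rewrite cons0 max_lift consS.
  rewrite big_ord_recl /=.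
  have -> : lo ord0 = ord0 :> 'I_(size ms).+2 by apply/val_inj.
  rewrite cons0 consS; congr (_ * _); apply: eq_bigr => l _.
  have -> : lo (lift ord0 l) = lift ord0 (lo l) by apply/val_inj.
  by rewrite !consS.
rewrite (bigD1 x) //= [X in _ + X]big1 ?addr0; last first.
  by move=> z /negbTE nz; rewrite nz big_pred0.
rewrite (partition_big (fun q : {ffun 'I_(size ms).+1 -> T} => q ord0) predT) //=.
apply: eq_bigr => w _; rewrite -IHms big_distrr /=.
by apply: eq_big => [q|q /andP[_ /eqP ->]]; rewrite ?eqxx // andbC.
Qed.

End Walks.

(** * From matrix products to branching programs *)

Section WalkABP.

Variables (F : fieldType) (N : nat) (T : finType) (x0 : T).
Variable ms : seq (T -> T -> {mpoly F[N]}).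
Hypothesis affine_ms : forall l x y, affine_linear (nth (fun _ _ => 0) ms l x y).

Let d := size ms.
(** The first and last layers keep only the state [x0], since a program has one start and one end
    node. *)
Let boundary (l : nat) := (l == 0%N) || (l == d).
Let lw (l : 'I_d.+1) : nat := if boundary l then 1%N else #|T|.
Let state (l : 'I_d.+1) (u : 'I_(lw l)) : T :=
  if boundary l then x0 else nth x0 (enum T) u.

Let state_inj l : injective (@state l).
Proof.
rewrite /state => u v; move: u v; rewrite /lw; case: (boundary l) => u v.
  by rewrite !ord1.
by move/eqP; rewrite nth_uniq ?enum_uniq -?cardE ?ltn_ord // => /eqP/val_inj.
Qed.

Let state_surj (l : 'I_d.+1) y : (boundary l -> y = x0) -> exists u, state (l := l) u = y.
Proof.
rewrite /state /lw; case: (boundary l) => [->//|_]; first by exists ord0.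
by exists (enum_rank y); rewrite -(enum_val_nth x0) enum_rankK.
Qed.

Definition walk_ABP : ABP F N.
Proof.
apply: (@MkABP F N d lw (fun l u v => nth (fun _ _ => 0) ms l (state u) (state v))).
- by rewrite /lw /boundary eqxx.
- by rewrite /lw /boundary eqxx orbT.
- by move=> l u v; apply: affine_ms.
Defined.

Lemma walk_ABP_poly : abp_poly walk_ABP = walk ms x0 x0.
Proof.
rewrite -walk_sum /abp_poly /=.
(* Node sequences embed into state sequences, with image the walks that start and end at [x0]. *)
pose h (p : {dffun forall l, 'I_(lw l)}) : {ffun 'I_d.+1 -> T} := [ffun l => state (p l)].
have h_inj : injective h.
  move=> p q /ffunP hpq; apply/ffunP => l; apply: state_inj.
  by have := hpq l; rewrite !ffunE.
transitivity (\sum_(q in [set h p | p in [set: {dffun forall l, 'I_(lw l)}]])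
    \prod_(l < d) nth (fun _ _ => 0) ms l (q (lo l)) (q (hi l))).
  rewrite big_imset /=; last by move=> p q _ _; apply: h_inj.
  apply: eq_big => [p|p _]; first by rewrite inE.
  by apply: eq_bigr => l _; rewrite !ffunE.
apply: eq_bigl => q; apply/imsetP/andP => [[p _ ->]|[/eqP q0 /eqP qd]].
  by rewrite !ffunE /state /boundary !eqxx orbT.
have [p pE] : exists p : forall l, 'I_(lw l), forall l, state (p l) = q l.
  apply: (@fin_all_exists 'I_d.+1 (fun l => 'I_(lw l)) (fun l u => @state l u = q l)) => l; apply: state_surj => /orP[] /eqP El.
    by rewrite -q0; congr (q _); apply/val_inj.
  by rewrite -qd; congr (q _); apply/val_inj.
exists [ffun l => p l] => //.
by apply/ffunP => l; rewrite !ffunE.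
Qed.

Lemma walk_ABP_size : (abp_size walk_ABP <= (size ms).+1 * #|T|)%N.
Proof.
apply: (@leq_trans (\sum_(l < d.+1) #|T|)); last by rewrite sum_nat_const card_ord.
apply: leq_sum => l _.
by rewrite /= /lw; case: (boundary l) => //; apply/card_gt0P; exists x0.
Qed.

End WalkABP.

(** * Composing programs as loops at a base state *)

Section Loops.

Variables (F : fieldType) (N : nat) (T : finType) (x0 : T).
Implicit Types (p q : {mpoly F[N]}) (d : nat).

Definition affine_layers (ms : seq (T -> T -> {mpoly F[N]})) :=
  forall l x y, affine_linear (nth (fun _ _ => 0) ms l x y).

(** Walks from [x0] to other states must cancel as well, so that concatenating layers multiplies the
    polynomials. *)
Definition loop_computes d p := exists ms : seq (T -> T -> {mpoly F[N]}),
  [/\ size ms = d, affine_layers ms & forall y, walk ms x0 y = if y == x0 then p else 0].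

Lemma affine_linear0 : affine_linear (0 : {mpoly F[N]}).
Proof. by rewrite /affine_linear msize0. Qed.

Lemma affine_linear1 : affine_linear (1 : {mpoly F[N]}).
Proof. by rewrite /affine_linear msize1. Qed.

Lemma affine_linearX i : affine_linear ('X_i : {mpoly F[N]}).
Proof. by rewrite /affine_linear msizeX mdeg1. Qed.

Lemma affine_layers_cons M ms :
  (forall x y, affine_linear (M x y)) -> affine_layers ms -> affine_layers (M :: ms).
Proof. by move=> affM affms [|l] x y; [apply: affM | apply: affms]. Qed.

Lemma affine_layers_nil : affine_layers [::].
Proof. by move=> l x y; rewrite nth_nil; apply: affine_linear0. Qed.

Lemma affine_layers_cat ms1 ms2 :
  affine_layers ms1 -> affine_layers ms2 -> affine_layers (ms1 ++ ms2).
Proof. by move=> aff1 aff2 l x y; rewrite nth_cat; case: ifP => _; [apply: aff1 | apply: aff2]. Qed.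

Lemma loop_computes1 : loop_computes 0 1.
Proof.
exists [::]; split=> //; first exact: affine_layers_nil.
by move=> y /=; rewrite eq_sym; case: (_ == _).
Qed.

Lemma loop_computesX i : loop_computes 1 'X_i.
Proof.
exists [:: fun x y => if (x == x0) && (y == x0) then 'X_i else 0]; split=> //.
  apply: affine_layers_cons affine_layers_nil => x y.
  by case: ifP => _; [apply: affine_linearX | apply: affine_linear0].
move=> y /=; rewrite (bigD1 y) //= !eqxx mulr1 big1 ?addr0 // => z /negbTE nz.
by rewrite nz mulr0.
Qed.

Lemma loop_computesM d1 d2 p q :
  loop_computes d1 p -> loop_computes d2 q -> loop_computes (d1 + d2) (p * q).
Proof.
move=> [ms1 [<- aff1 w1]] [ms2 [<- aff2 w2]]; exists (ms1 ++ ms2); split.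
- by rewrite size_cat.
- exact: affine_layers_cat.
move=> y; rewrite walk_cat (bigD1 x0) //= w1 eqxx w2 big1 ?addr0 => [|z /negbTE nz].
  by case: (y == x0); rewrite ?mulr0.
by rewrite w1 nz mul0r.
Qed.

Lemma loop_computes_prod (I : Type) (s : seq I) (P : pred I) (f : I -> {mpoly F[N]}) d :
  (forall i, P i -> loop_computes d (f i)) ->
  loop_computes (count P s * d) (\prod_(i <- s | P i) f i).
Proof.
move=> hf; elim: s => [|i s IHs]; first by rewrite big_nil; apply: loop_computes1.
rewrite big_cons /=; case: ifP => // Pi.
by rewrite mulnDl mul1n; apply: loop_computesM IHs; apply: hf.
Qed.

Lemma loop_computes_ABP d p : loop_computes d p ->
  exists A : ABP F N, abp_poly A = p /\ (abp_size A <= d.+1 * #|T|)%N.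
Proof.
move=> [ms [<- aff w]]; exists (walk_ABP x0 aff).
by rewrite walk_ABP_poly w eqxx; split=> //; apply: walk_ABP_size.
Qed.

End Loops.

(** * The hard polynomial *)

Section Multidegree.

Variables (F : fieldType) (N m : nat) (part : 'I_N -> 'I_m).
Implicit Types (p q : {mpoly F[N]}) (w : 'I_m -> nat).

(** Set-multilinearity is the case where [w] is constantly 1; general [w] lets the factors of a
    product be treated separately. *)
Definition multihomog w p := forall mon, mon \in msupp p ->
  forall j, (\sum_(i | part i == j) mon i)%N = w j.

Lemma multihomog_ext w w' p : w =1 w' -> multihomog w p -> multihomog w' p.
Proof. by move=> eq_w hp mon /hp{}hp j; rewrite hp. Qed.

Lemma multihomog1 : multihomog (fun _ => 0%N) 1.
Proof. by move=> mon; rewrite msupp1 inE => /eqP -> j; rewrite big1 // => i _; rewrite mnm0E. Qed.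

Lemma multihomogX i : multihomog (fun j => part i == j : nat) 'X_i.
Proof.
move=> mon; rewrite msuppX inE => /eqP -> j; rewrite big_mkcond (bigD1 i) //= mnm1E eqxx.
rewrite big1 ?addn0 => [|i' /negbTE ni]; first by case: (_ == _).
by rewrite mnm1E [i == _]eq_sym ni; case: ifP.
Qed.

Lemma multihomogM w w' p q : multihomog w p -> multihomog w' q ->
  multihomog (fun j => w j + w' j)%N (p * q).
Proof.
move=> hp hq mon /msuppM_le /allpairsP[[m1 m2] /= [m1p m2q ->]] j.
by rewrite -(hp _ m1p) -(hq _ m2q) -big_split; apply: eq_bigr => i _; rewrite mnmDE.
Qed.

Lemma multihomogD w p q : multihomog w p -> multihomog w q -> multihomog w (p + q).
Proof. by move=> hp hq mon /msuppD_le; rewrite mem_cat => /orP[/hp|/hq]. Qed.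

Lemma multihomog_sum (I : Type) (s : seq I) (P : pred I) (f : I -> {mpoly F[N]}) w :
  (forall i, P i -> multihomog w (f i)) -> multihomog w (\sum_(i <- s | P i) f i).
Proof.
move=> hf; elim/big_ind: _ => //; first by move=> mon; rewrite msupp0.
by move=> p q; apply: multihomogD.
Qed.

Lemma multihomog_prod (I : Type) (s : seq I) (P : pred I) (f : I -> {mpoly F[N]})
    (w : I -> 'I_m -> nat) :
  (forall i, P i -> multihomog (w i) (f i)) ->
  multihomog (fun j => \sum_(i <- s | P i) w i j)%N (\prod_(i <- s | P i) f i).
Proof.
move=> hf; elim: s => [|i s IHs].
  by rewrite big_nil; apply: multihomog_ext multihomog1 => j; rewrite big_nil.
rewrite big_cons; case: ifP => Pi.
  apply: multihomog_ext (multihomogM (hf _ Pi) IHs) => j.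
  by rewrite big_cons Pi.
by apply: multihomog_ext IHs => j; rewrite big_cons Pi.
Qed.

Lemma mdeg_set_multilinear p mon : set_multilinear part p -> mon \in msupp p -> mdeg mon = m.
Proof.
move=> hp monp; rewrite mdegE (partition_big part predT) //=.
by rewrite (eq_bigr (fun _ => 1%N)) => [|j _]; rewrite ?hp // sum1_card card_ord.
Qed.

Lemma tdeg_set_multilinear_le p : set_multilinear part p -> (tdeg p <= m)%N.
Proof.
move=> hp; rewrite /tdeg; have [->|nzp] := eqVneq p 0; first by rewrite msize0.
by rewrite -mlead_deg // (mdeg_set_multilinear hp) ?mlead_supp.
Qed.

Lemma tdeg_set_multilinear p : set_multilinear part p -> p != 0 -> tdeg p = m.
Proof.
by move=> hp nzp; rewrite /tdeg -mlead_deg // (mdeg_set_multilinear hp) ?mlead_supp.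
Qed.

End Multidegree.

(** * Construction and set-multilinearity *)

Section Hard.

Variables (F : fieldType) (N m r b : nat).
Variables (part : 'I_N -> 'I_m) (var : 'I_m -> nat -> 'I_N).
Hypothesis part_var : forall j c, part (var j c) = j.

Local Notation edge := ('I_r * 'I_b.+1)%type.
Local Notation slot := (edge * bool + 'I_r)%type.

(* [role] places the core parts: [inl (e, false)] and [inl (e, true)] are the
   left and right part with index [e], [inr g] is the selector of group [g];
   parts outside its image are padding. *)
Variable role : slot -> 'I_m.
Hypothesis role_inj : injective role.

Definition left_part (e : edge) := role (inl (e, false)).
Definition right_part (e : edge) := role (inl (e, true)).
Definition selector (g : 'I_r) := role (inr g).

Definition pairing (u v : 'I_m) : {mpoly F[N]} := \sum_(c : bool) 'X_(var u c) * 'X_(var v c).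

Definition group_poly (g : 'I_r) : {mpoly F[N]} :=
  \sum_(k < b.+1) 'X_(var (selector g) k) *
     \prod_(i < b.+1) pairing (left_part (g, i)) (right_part (g, i + k)).

(** One variable of each padding part is multiplied in, so that every part occurs. *)
Definition hard_poly : {mpoly F[N]} :=
  (\prod_g group_poly g) * \prod_(j | j \notin codom role) 'X_(var j 0).

Lemma multihomog_var j c : multihomog part (fun j' => j == j' : nat) ('X_(var j c) : {mpoly F[N]}).
Proof. by have := @multihomogX F N m part (var j c); rewrite part_var. Qed.

(** All summands have the same multidegree, because a shift merely permutes the right parts of the
    group. *)
Lemma multihomog_group g : multihomog part
  (fun j => (selector g == j) + \sum_(i < b.+1) ((left_part (g, i) == j) + (right_part (g, i) == j)))%N
  (group_poly g).
Proof.
apply: multihomog_sum => k _.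
have hpair u v : multihomog part (fun j => (u == j) + (v == j))%N (pairing u v).
  by apply: multihomog_sum => c _; apply: multihomogM; apply: multihomog_var.
apply: (@multihomog_ext F N m part (fun j => (selector g == j) +
    \sum_(i < b.+1) ((left_part (g, i) == j) + (right_part (g, i + k)%R == j)))%N) => [j|]; last first.
  apply: multihomogM; first exact: multihomog_var.
  by apply: (@multihomog_prod F N m part 'I_b.+1 _ _ _
    (fun i j => (left_part (g, i) == j) + (right_part (g, i + k)%R == j))%N).
congr (_ + _)%N; rewrite !big_split; congr (_ + _)%N.
by rewrite [RHS](reindex_inj (addIr k)).
Qed.

Lemma hard_poly_set_multilinear : set_multilinear part hard_poly.
Proof.
apply: (@multihomog_ext F N m part (fun j => \sum_g ((selector g == j) +
      \sum_(i < b.+1) ((left_part (g, i) == j) + (right_part (g, i) == j)))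
    + \sum_(i | i \notin codom role) (i == j))%N) => [j|]; last first.
  apply: multihomogM.
    by apply: (@multihomog_prod F N m part 'I_r _ _ _ (fun g j => (selector g == j) +
      \sum_(i < b.+1) ((left_part (g, i) == j) + (right_part (g, i) == j)))%N) => g _;
      apply: multihomog_group.
  by apply: (@multihomog_prod F N m part 'I_m _ _ _ (fun i j => (i == j : nat))) => i _;
    apply: multihomog_var.
transitivity (\sum_(t : slot) (role t == j) + \sum_(i | i \notin codom role) (i == j))%N.
  congr (_ + _)%N; rewrite big_sumType /= [RHS]addnC big_split; congr (_ + _)%N.
  transitivity (\sum_(e : edge) \sum_(c : bool) (role (inl (e, c)) == j))%N.
    by rewrite pair_bigA; apply: eq_bigr => -[g i] _; rewrite big_bool addnC.
  by rewrite pair_bigA; apply: eq_bigr => -[e c].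
have [/codomP[t ->]|jnot] := boolP (j \in codom role).
  rewrite (bigD1 t) //= eqxx !big1 // => [i|t' /negbTE nt].
    by case: eqVneq => // ->; rewrite codom_f.
  by rewrite (inj_eq role_inj) nt.
rewrite big1 => [|t _].
  rewrite (bigD1 j) //= eqxx big1 // => i /andP[_ /negbTE ->] //.
by case: eqVneq => // rt; rewrite -rt codom_f in jnot.
Qed.

(** * Values at 0/1 points *)

Section Evaluation.

Variable K : nat.
Hypothesis var_inj : forall j c c', (c < K)%N -> (c' < K)%N -> var j c = var j c' -> c = c'.
Hypotheses (K2 : (1 < K)%N) (Kb : (b < K)%N).

Variables (k : {ffun 'I_r -> 'I_b.+1}) (x : {set edge}).

(** The right part of index [i] is matched with the left part of index [i - k g], so it takes the
    bit of that pair; membership in [x] exchanges the two players. *)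
Definition choice (a c : {set edge}) (t : slot) : nat :=
  match t with
  | inl (e, false) => if e \in x then e \in c else e \in a
  | inl ((g, i), true) => let e := (g, i - k g) in if e \in x then e \in a else e \in c
  | inr g => k g
  end.

(** The default 0 selects exactly the padding variables that occur in [hard_poly]. *)
Definition choice_part a c (j : 'I_m) : nat :=
  if [pick t | role t == j] is Some t then choice a c t else 0%N.

Definition point a c (i : 'I_N) : F := (i == var (part i) (choice_part a c (part i)))%:R.

Lemma choice_part_role a c t : choice_part a c (role t) = choice a c t.
Proof.
rewrite /choice_part; case: pickP => [t' /eqP/role_inj -> //|/(_ t)].
by rewrite eqxx.
Qed.

Lemma choice_partN a c j : j \notin codom role -> choice_part a c j = 0%N.
Proof.
by move=> jnot; rewrite /choice_part; case: pickP => // t /eqP rt; rewrite -rt codom_f in jnot.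
Qed.

Lemma choice_bound a c t : (choice a c t < K)%N.
Proof.
have bK (B : bool) : (B < K)%N by apply: leq_ltn_trans K2; case: B.
case: t => [[[g i] []]|g] /=; last by apply: leq_trans Kb.
  by case: ifP.
by case: ifP.
Qed.

Lemma meval_var a c j d : (d < K)%N -> (choice_part a c j < K)%N ->
  ('X_(var j d) : {mpoly F[N]}).@[point a c] = (d == choice_part a c j)%:R.
Proof.
move=> dK cK; rewrite mevalXU /point part_var; congr ((nat_of_bool _)%:R).
by apply/eqP/eqP => [/var_inj->//|->].
Qed.

Lemma reads_point : reads part
  (fun e => if e \in x then right_part (shift_edge k e) else left_part e)
  (fun e => if e \in x then left_part e else right_part (shift_edge k e))
  point.
Proof.
move=> a c a' c' i ya zc; rewrite /point; congr ((_ == var _ _)%:R).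
rewrite /choice_part; case: pickP => // t /eqP rt.
case: t rt => [[[g j] []]|g] rt //=.
  have sE : right_part (shift_edge k (g, j - k g)) = part i.
    by rewrite -rt /right_part /shift_edge /= subrK.
  case: ifP => ex; congr nat_of_bool.
    by apply: ya; rewrite ex.
  by apply: zc; rewrite ex.
case: ifP => ex; congr nat_of_bool.
  by apply: zc; rewrite ex.
by apply: ya; rewrite ex.
Qed.

(** The selector kills every shift but [k g], and a pairing then evaluates to 1 exactly when its two
    ends choose the same bit. *)
Lemma meval_group a c g :
  (group_poly g).@[point a c] = \prod_i (((g, i) \in a) == ((g, i) \in c))%:R.
Proof.
rewrite raddf_sum (bigD1 (k g)) //= [X in _ + X]big1 ?addr0 => [|k' nk]; last first.
  rewrite rmorphM /= meval_var ?choice_part_role ?choice_bound //=.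
    by rewrite (inj_eq val_inj) (negbTE nk) mul0r.
  by apply: leq_trans Kb.
rewrite rmorphM /= meval_var ?choice_part_role ?choice_bound //=; last by apply: leq_trans Kb.
rewrite eqxx mul1r rmorph_prod; apply: eq_bigr => i _.
rewrite raddf_sum /= big_bool !mevalM /=.
rewrite !meval_var ?choice_part_role ?choice_bound //=; try by apply: leq_ltn_trans K2.
rewrite addrK; case: ((g, i) \in x); case: (_ \in a); case: (_ \in c);
  by rewrite /= ?mul0r ?mulr0 ?mul1r ?addr0 ?add0r.
Qed.

Lemma meval_hard a c : hard_poly.@[point a c] = (a == c)%:R.
Proof.
rewrite rmorphM !rmorph_prod /= [X in _ * X]big1 ?mulr1 => [|j jnot]; last first.
  by rewrite meval_var ?choice_partN //; apply: ltn_trans K2.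
rewrite (eq_bigr _ (fun g _ => meval_group a c g)) pair_bigA /=.
have [->|nac] := eqVneq a c; first by rewrite big1 // => e _; rewrite eqxx.
have [e ne] : exists e, (e \in a) != (e \in c).
  apply/existsP; apply: contraR nac => /existsPn eq_ac; apply/eqP/setP => e.
  by apply/eqP; have := eq_ac e; rewrite negbK.
by rewrite (bigD1 e) //=; case: e ne => g i /= /negbTE ->; rewrite mul0r.
Qed.

End Evaluation.

End Hard.

(** * A small program for the hard polynomial *)

Section HardABP.

Variables (F : fieldType) (N m r b : nat).
Variables (var : 'I_m -> nat -> 'I_N) (role : ('I_r * 'I_b.+1) * bool + 'I_r -> 'I_m).

(** A state remembers the selected shift and the bit read at the left end of the current pair. *)
Local Notation state := ('I_b.+1 * bool)%type.
Local Notation layer := (state -> state -> {mpoly F[N]}).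

Definition base_state : state := (ord0, false).

Definition select_layer g : layer := fun x y =>
  if (x == base_state) && ~~ y.2 then 'X_(var (selector role g) y.1) else 0.

Definition left_layer g i : layer := fun x y =>
  if (x.1 == y.1) && ~~ x.2 then 'X_(var (left_part role (g, i)) y.2) else 0.

Definition right_layer g i : layer := fun x y =>
  if (x.1 == y.1) && ~~ y.2 then 'X_(var (right_part role (g, i + x.1)) x.2) else 0.

Definition return_layer : layer := fun x y => if ~~ x.2 && (y == base_state) then 1 else 0.

Definition pair_layers g (s : seq 'I_b.+1) := flatten [seq [:: left_layer g i; right_layer g i] | i <- s].

(** A left layer stores the bit [c] and the following right layer consumes it; together they
    contribute one [pairing] and return to [(k, false)]. *)
Lemma walk_pair_layers g s (k : 'I_b.+1) (y : state) :
  walk (pair_layers g s) (k, false) y =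
    if y == (k, false) then
      \prod_(i <- s) pairing F var (left_part role (g, i)) (right_part role (g, i + k))
    else 0.
Proof.
elim: s => [|i s IHs] /=; first by rewrite eq_sym big_nil; case: (_ == _).
transitivity (\sum_(c : bool) 'X_(var (left_part role (g, i)) c)
    * \sum_z right_layer g i (k, c) z * walk (pair_layers g s) z y).
  rewrite -(pair_bigA _ (fun k' c => left_layer g i (k, false) (k', c) *
     \sum_z right_layer g i (k', c) z * walk (pair_layers g s) z y)) /=.
  rewrite (bigD1 k) //= [X in _ + X]big1 ?addr0 => [|k' /negbTE nk].
    by apply: eq_bigr => c _; rewrite /left_layer /= eqxx.
  by apply: big1 => c _; rewrite /left_layer /= eq_sym nk mul0r.
transitivity (pairing F var (left_part role (g, i)) (right_part role (g, i + k)) *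
    walk (pair_layers g s) (k, false) y).
  rewrite /pairing big_distrl; apply: eq_bigr => c _ /=; rewrite -mulrA; congr (_ * _).
  rewrite (bigD1 (k, false)) //= /right_layer /= eqxx big1 ?addr0 // => -[k' c'] /=.
  rewrite xpair_eqE eq_sym; case: (k == k') => //=; last by rewrite mul0r.
  by case: c' => //=; rewrite mul0r.
by rewrite IHs big_cons; case: ifP => // _; rewrite mulr0.
Qed.

(** One layer selects the shift, two serve each of the [b.+1] pairs, and a last one forgets the
    shift. *)
Lemma group_poly_loop g : loop_computes base_state (b.+1.*2.+2) (group_poly F var role g).
Proof.
exists (select_layer g :: pair_layers g (enum 'I_b.+1) ++ [:: return_layer]); split.
- rewrite /= size_cat size_flatten /shape -map_comp addn1.
  rewrite (_ : map _ _ = nseq b.+1 2%N); first by rewrite sumn_nseq mul2n.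
  by rewrite -[in RHS](size_enum_ord b.+1); elim: (enum _) => //= i s ->.
- apply: affine_layers_cons => [x y|].
    by rewrite /select_layer; case: ifP => _; [apply: affine_linearX | apply: affine_linear0].
  apply: affine_layers_cat; last first.
    apply: affine_layers_cons (@affine_layers_nil _ _ _) => x y.
    by rewrite /return_layer; case: ifP => _; [apply: affine_linear1 | apply: affine_linear0].
  rewrite /pair_layers; elim: (enum _) => [|i s IHs] /=; first exact: affine_layers_nil.
  do 2?[apply: affine_layers_cons => [x y|]] => //.
    by rewrite /left_layer; case: ifP => _; [apply: affine_linearX | apply: affine_linear0].
  by rewrite /right_layer; case: ifP => _; [apply: affine_linearX | apply: affine_linear0].
move=> y /=.
transitivity (\sum_(k < b.+1) 'X_(var (selector role g) k) *
   walk (pair_layers g (enum 'I_b.+1) ++ [:: return_layer]) (k, false) y).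
  transitivity (\sum_(k < b.+1) \sum_(c : bool) select_layer g base_state (k, c) *
     walk (pair_layers g (enum 'I_b.+1) ++ [:: return_layer]) (k, c) y).
    by rewrite pair_bigA; apply: eq_bigr => -[k c].
  apply: eq_bigr => k _; rewrite big_bool /select_layer /= ?eqxx /= mul0r.
  by rewrite add0r.
have walk_return k : walk (pair_layers g (enum 'I_b.+1) ++ [:: return_layer]) (k, false) y =
    if y == base_state then
      \prod_i pairing F var (left_part role (g, i)) (right_part role (g, i + k)) else 0.
  rewrite walk_cat (bigD1 (k, false)) //= walk_pair_layers eqxx big_enum.
  rewrite [X in _ + X]big1 ?addr0 => [|z /negbTE nz]; last first.
    by rewrite walk_pair_layers nz mul0r.
  rewrite (bigD1 y) //= eqxx mulr1 [X in _ + X]big1 ?addr0 => [|z /negbTE nz].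
    by rewrite /return_layer /=; case: ifP; rewrite ?mulr1 ?mulr0.
  by rewrite nz mulr0.
rewrite /group_poly (eq_bigr _ (fun k _ => congr1 _ (walk_return k))).
case: ifP => // _; apply: big1 => k _; exact: mulr0.
Qed.

Lemma hard_poly_ABP : exists A : ABP F N, abp_poly A = hard_poly F var role /\
  (abp_size A <= (r * b.+1.*2.+2 + m).+1 * b.+1.*2)%N.
Proof.
have loop1 := loop_computes_prod (index_enum 'I_r) (fun g (_ : predT g) => group_poly_loop g).
have loop2 := loop_computes_prod (index_enum 'I_m)
  (fun j (_ : j \notin codom role) => loop_computesX F base_state (var j 0)).
have [A [AE sizeA]] := loop_computes_ABP (loop_computesM loop1 loop2).
exists A; split=> //; apply: leq_trans sizeA _.
rewrite card_prod card_ord card_bool muln2 leq_mul2r ltnS; apply/orP; right.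
apply: leq_add.
  by rewrite leq_mul2r count_predT -sum1_size sum1_card card_ord leqnn orbT.
by rewrite muln1 (leq_trans (count_size _ _)) // -sum1_size sum1_card card_ord.
Qed.

End HardABP.

Local Close Scope ring_scope.

(** * Choice of sizes and conclusion *)

Section GroupCount.

(* The number of core parts for [r = z] groups of size [b = z ^ 10 + 1];
   chunks have size [C = z ^ 8]. *)
Definition slot_count (z : nat) := (2 * (z * (z ^ 10).+1) + z)%N.

Definition group_count (n : nat) : nat := \max_(z < n.+1 | slot_count z <= n) z.

Lemma slot_count_group n : slot_count (group_count n) <= n.
Proof.
rewrite /group_count; elim/big_ind: _ => // x y Hx Hy.
by rewrite /maxn; case: ifP.
Qed.

Lemma group_count_max n z : slot_count z <= n -> z <= group_count n.
Proof.
move=> zn; have lt_z : z < n.+1 by rewrite ltnS (leq_trans _ zn) // leq_addl.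
exact: (@leq_bigmax_cond _ (fun i : 'I_n.+1 => slot_count i <= n) (fun i => i : nat) (Ordinal lt_z)).
Qed.

Lemma group_count_unbounded z : exists n0, forall n, n0 <= n -> z <= group_count n.
Proof. by exists (slot_count z) => n; apply: group_count_max. Qed.

(** By maximality [n < slot_count z.+1], and [2 y ^ 11 + 3 y <= 5 y ^ 11] for [y = z.+1]. *)
Lemma lt_group_count n : n < 5 * (group_count n).+1 ^ 11.
Proof.
set z := group_count n.
have : n < slot_count z.+1 by rewrite ltnNge; apply/negP => /group_count_max; rewrite ltnn.
move=> /leq_trans; apply; rewrite /slot_count.
have : z.+1 <= z.+1 ^ 11 by rewrite -[leqLHS]expn1 leq_pexp2l.
have -> : z.+1 ^ 11 = z.+1 * z.+1 ^ 10 by rewrite -expnS.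
by move: (z.+1 ^ 10) => a; lia.
Qed.

Lemma group_size_lt n : 0 < group_count n -> (group_count n ^ 10).+1 < n.
Proof.
move=> z0; apply: leq_trans (slot_count_group n); rewrite /slot_count.
by move: z0; case: (group_count n) => // z _; move: (_ ^ 10) => a; lia.
Qed.

Lemma hard_ABP_size_bound n (z := group_count n) (b := z ^ 10) :
  (z * b.+1.*2.+2 + n).+1 * b.+1.*2 <= n ^ 12 + 12.
Proof.
have le_n : 2 * (z * b.+1) + z <= n := slot_count_group n.
have le_b : b.+1.*2 <= n + 2.
  case: (posnP z) => [z0|z0]; first by rewrite /b z0 exp0n // addn2.
  have : b.+1 <= z * b.+1 by rewrite leq_pmull.
  by move: le_n; move: (z * _) => y; lia.
apply: (@leq_trans ((3 * n).+1 * (n + 2))).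
  by apply: leq_mul le_b; rewrite ltnS; move: le_n; clear; lia.
(* The additive 12 covers [n <= 1]; from 2 on, [16 n ^ 2] already suffices. *)
case: n {z b le_n le_b} => [|[|n]] //.
have : 2 ^ 4 <= n.+2 ^ 4 by rewrite leq_exp2r.
have -> : n.+2 ^ 12 = n.+2 ^ 4 * n.+2 ^ 6 * n.+2 ^ 2 by rewrite -!expnD.
have : 1 <= n.+2 ^ 6 by rewrite expn_gt0.
rewrite [n.+2 ^ 2]expnS expn1; move: (n.+2 ^ 4) (n.+2 ^ 6) => a c c1 a16.
apply: (@leq_trans (2 ^ 4 * 1 * (n.+2 * n.+2))); first by lia.
by rewrite (leq_trans _ (leq_addr _ _)) // leq_mul2r leq_mul ?orbT.
Qed.

End GroupCount.

(** * The family in [n * n] variables and its width bound *)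

Section Family.

Variables (F : fieldType) (n : nat).

(** The variables are the entries of an [n] by [n] matrix, whose rows are the parts. *)
Definition part_of (i : 'I_(n * n)) : 'I_n := (enum_val (cast_ord (esym (mxvec_cast n n)) i)).1.

Definition var_of (j : 'I_n) (c : nat) : 'I_(n * n) := mxvec_index j (insubd j c).

Lemma part_of_var j c : part_of (var_of j c) = j.
Proof. by rewrite /part_of /var_of /mxvec_index cast_ordK enum_rankK. Qed.

Lemma var_of_inj j c c' : c < n -> c' < n -> var_of j c = var_of j c' -> c = c'.
Proof.
move=> cn c'n /cast_ord_inj/enum_rank_inj[] /(congr1 val).
by rewrite !val_insubd cn c'n.
Qed.

Let z := group_count n.
Let b := z ^ 10.

Lemma card_slot_le : #|{: ('I_z * 'I_b.+1) * bool + 'I_z}| <= n.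
Proof.
rewrite card_sum !card_prod card_bool !card_ord mulnC.
exact: slot_count_group.
Qed.

Definition role_of (t : ('I_z * 'I_b.+1) * bool + 'I_z) : 'I_n :=
  widen_ord card_slot_le (enum_rank t).

Lemma role_of_inj : injective role_of.
Proof. by move=> t t' /(congr1 val) /= /val_inj/enum_rank_inj. Qed.

Definition hard_family : {mpoly F[n * n]} := hard_poly F var_of role_of.

Lemma hard_family_set_multilinear : set_multilinear part_of hard_family.
Proof. by apply: hard_poly_set_multilinear; [apply: part_of_var | apply: role_of_inj]. Qed.

Lemma hard_family_neq0 : 0 < z -> hard_family != 0%R.
Proof.
move=> z0; have lt_b := group_size_lt z0.
have n1 : 1 < n by apply: leq_ltn_trans lt_b.
have := meval_hard F part_of_var role_of_inj var_of_inj n1 (ltnW lt_b)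
  [ffun=> ord0] set0 set0 set0.
by rewrite eqxx -/hard_family; apply: contra_eq_neq => ->; rewrite meval0 eq_sym oner_neq0.
Qed.

(** Arguing by contradiction bounds the number of programs, each of width at least 1, by the total
    width; there are then fewer than [2 ^ z] orders, as [exists_unbalanced] demands. *)
Lemma hard_family_total_width (s : seq (smABP F (n * n) n part_of)) :
  16 <= z -> sum_smABP_computes s hard_family -> 2 ^ z <= total_width s.
Proof.
move=> z16 sG; have z0 : 0 < z by apply: leq_trans z16.
have lt_b := group_size_lt z0.
have n1 : 1 < n by apply: leq_ltn_trans lt_b.
rewrite leqNgt; apply/negP => lt_s.
have size_s : size s <= total_width s.
  rewrite /total_width -sum1_size; apply: leq_sum => A _.
  by rewrite -(sm_start _ _ _ _ A); apply: (leq_bigmax ord0).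
have injL : injective (left_part role_of) by move=> e e' /role_of_inj[].
have injR : injective (right_part role_of) by move=> e e' /role_of_inj[].
have [|k [x unbal]] := @exists_unbalanced z n [seq (sm_sigma A)^-1%g | A <- s] _ _
  injL injR z16 (lt_group_count n).
  by rewrite size_map (leq_ltn_trans size_s).
have := total_width_unbalanced
  (@reads_point F _ _ _ _ part_of var_of role_of k x) sG
  (meval_hard F part_of_var role_of_inj var_of_inj n1 (ltnW lt_b) k x) unbal.
by rewrite leqNgt lt_s.
Qed.

End Family.

(** * From [2 ^ z] to an exponential in a power of [n] *)

Module RealBounds.
Import Rdefinitions Raxioms RIneq Rpow_def Rfunctions Rtrigo_def Rpower Lra.
Local Open Scope R_scope.

Lemma INR_leq (a b : nat) : (a <= b)%nat -> INR a <= INR b.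
Proof. by move=> /ssrnat.leP; apply: le_INR. Qed.

Lemma INR_exp2 (z : nat) : INR (expn 2 z)%nat = exp (ln 2 * INR z).
Proof.
have -> : INR (expn 2 z)%nat = pow 2 z.
  elim: z => [|z IHz]; first by [].
  by rewrite expnS mult_INR IHz /=; lra.
rewrite -Rpower_pow; last by lra.
by rewrite /Rpower Rmult_comm.
Qed.

Lemma INR_expn (a d : nat) : INR (expn a d)%nat = pow (INR a) d.
Proof. by elim: d => [|d IHd] //; rewrite expnS mult_INR IHd. Qed.

(** Since [5 <= z + 1], [n] is below [(z + 1) ^ 100], so its hundredth root is at most
    [z + 1 <= 2 z]; this gives [c = ln 2 / 2]. *)
Lemma exp_root_le : exists c : R, 0 < c /\ forall n z w : nat,
  (0 < n)%nat -> (16 <= z)%nat -> (n < 5 * expn z.+1 11)%nat -> (expn 2 z <= w)%nat ->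
  exp (c * Rpower (INR n) (/ INR 100)) <= INR w.
Proof.
have ln2 : 0 < ln 2 / 2 by have : 0 < ln 2 by [rewrite -ln_1; apply: ln_increasing; lra]; lra.
exists (ln 2 / 2); split=> // n z w n0 z16 lt_n /INR_leq.
rewrite INR_exp2; apply: Rle_trans.
have le_exp u v : u <= v -> exp u <= exp v.
  by case=> [lt_uv|->]; [left; apply: exp_increasing | right].
apply: le_exp.
have z1 : 1 <= INR z by apply: (INR_leq (a := 1)); lia.
suff root_le : Rpower (INR n) (/ INR 100) <= INR z + 1.
  by have := Rmult_le_compat_l (ln 2 / 2) _ _ _ root_le; nra.
have le_n : (n <= expn z.+1 100)%nat.
  apply: ltnW; apply: leq_trans lt_n _.
  rewrite (_ : 100 = 89 + 11)%nat // expnD leq_mul2r; apply/orP; right.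
  by apply: (@leq_trans (expn z.+1 1)); [rewrite expn1; lia | rewrite leq_pexp2l].
have INR100 : INR 100 <> 0 by apply: not_0_INR.
have <- : Rpower (INR (expn z.+1 100)%nat) (/ INR 100) = INR z + 1.
  rewrite INR_expn S_INR -Rpower_pow; last by lra.
  by rewrite Rpower_mult Rinv_r // Rpower_1; lra.
apply: Rle_Rpower_l; first by left; apply/Rinv_0_lt_compat/lt_0_INR/ssrnat.ltP.
by split; [apply/lt_0_INR/ssrnat.ltP | apply: INR_leq].
Qed.

End RealBounds.

Theorem theorem1p5 (F : fieldType) :
  exists delta : Rdefinitions.R, Rdefinitions.Rle (Rdefinitions.Rinv (Raxioms.INR 100)) delta /\
  exists (Nv m : nat -> nat) (part : forall n, 'I_(Nv n) -> 'I_(m n))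
         (G : forall n, {mpoly F[Nv n]}),
    (forall n, set_multilinear (part n) (G n)) /\
    inVBP G /\
    bigTheta Nv (fun n => (n * n)%N) /\
    bigTheta (fun n => tdeg (G n)) (fun n => n) /\
    exists c : Rdefinitions.R, Rdefinitions.Rlt Rdefinitions.R0 c /\ exists n0 : nat, forall n : nat, (n0 <= n)%N ->
      forall s : seq (smABP F (Nv n) (m n) (part n)),
        sum_smABP_computes s (G n) ->
        Rdefinitions.Rle (Rtrigo_def.exp (Rdefinitions.Rmult c (Rpower.Rpower (Raxioms.INR n) delta))) (Raxioms.INR (total_width s)).
Proof.
have [n0 n0P] := group_count_unbounded 16.
exists (Rdefinitions.Rinv (Raxioms.INR 100)); split; first exact: RIneq.Rle_refl.
exists (fun n => n * n)%N, id, part_of, (hard_family F).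
split; first exact: hard_family_set_multilinear.
split.
  exists 12 => n; split.
    apply: leq_trans (tdeg_set_multilinear_le (@hard_family_set_multilinear F n)) _.
    by case: n => // n; rewrite (leq_trans _ (leq_addr _ _)) // -[leqLHS]expn1 leq_pexp2l.
  have [A [AE sizeA]] := hard_poly_ABP F (@var_of n) (@role_of n).
  by exists A; split=> //; apply: leq_trans sizeA (hard_ABP_size_bound n).
split.
  exists Rdefinitions.R1, Rdefinitions.R1; split; first exact: RIneq.Rlt_0_1.
  split; first exact: RIneq.Rlt_0_1.
  by exists 0%N => n _; rewrite Raxioms.Rmult_1_l; split; apply: RIneq.Rle_refl.
split.
  exists Rdefinitions.R1, Rdefinitions.R1; split; first exact: RIneq.Rlt_0_1.
  split; first exact: RIneq.Rlt_0_1.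
  exists n0 => n /n0P z16; rewrite Raxioms.Rmult_1_l.
  (* A non-zero set-multilinear polynomial has degree exactly [n]; being non-zero is ensured here by
     a positive [group_count n]. *)
  rewrite (tdeg_set_multilinear (@hard_family_set_multilinear F n)); last first.
    by apply: hard_family_neq0; apply: leq_trans z16.
  by split; apply: RIneq.Rle_refl.
have [c [c0 cP]] := RealBounds.exp_root_le.
exists c; split=> //; exists n0 => n /n0P z16 s sG.
have z0 : 0 < group_count n by apply: leq_trans z16.
exact: cP (leq_trans _ (group_size_lt z0)) z16 (lt_group_count n) (hard_family_total_width z16 sG).
Qed.
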